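(* Let $X=\{X(t), t\in\mathbb{R}^d\}$ be a stochastically continuous and proper random field with values in $\mathbb{R}^m$. (i) If $X$ is operator-self-similar (o.s.s.) with time-variable scaling exponent $E\in Q(\mathbb{R}^d)$, then there exists a matrix $D\in M(\mathbb{R}^m)$ such that for all $r>0$ $$\{X(r^E t),\ t\in\mathbb{R}^d\}\stackrel{d}{=}\{r^D X(t),\ t\in\mathbb{R}^d\}.$$ Moreover, $D\in Q(\mathbb{R}^m)$ if and only if $X(0)=0$ a.s. (ii) If $X$ is o.s.s. with time-variable scaling exponent $E\in Q(\mathbb{R}^d)$ in the sense of Hudson and Mason, then there exist a matrix $D\in M(\mathbb{R}^m)$ and a continuous function $b:(0,\infty)\to\mathbb{R}^m$ such that for all constants $r>0$ $$\{X(r^E t),\ t\in\mathbb{R}^d\}\stackrel{d}{=}\{r^D X(t)+b(r),\ t\in\mathbb{R}^d\}.$$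
   Context: $d\ge 2$ and $m\ge 2$ are fixed integers. $\stackrel{d}{=}$ means equality of all finite-dimensional distributions. For a square matrix $A$ and $r>0$, $r^A:=\sum_{n\ge 0}\frac{(\ln r)^n A^n}{n!}$. $Q(\mathbb{R}^n)$ is the set of invertible real $n\times n$ matrices all of whose eigenvalues have positive real parts. $M(\mathbb{R}^n)$ is the set of real $n\times n$ matrices all of whose eigenvalues have nonnegative real parts and such that every eigenvalue with real part zero (if any) is a simple root of the minimal polynomial. A random field $X=\{X(t),t\in\mathbb{R}^d\}$ with values in $\mathbb{R}^m$ is o.s.s. with time-variable scaling exponent $E$ if for every constant $r>0$ there exists a non-random $m\times m$ matrix $B(r)$ such that $\{X(r^Et),t\in\mathbb{R}^d\}\stackrel{d}{=}\{B(r)X(t),t\in\mathbb{R}^d\}$. It is o.s.s. in the sense of Hudson and Mason with time-variable scaling exponent $E$ if for every $r>0$ there exist a non-random $m\times m$ matrix $B(r)$ and a vector $a(r)\in\mathbb{R}^m$ such that $\{X(r^Et),t\in\mathbb{R}^d\}\stackrel{d}{=}\{B(r)X(t)+a(r),t\in\mathbb{R}^d\}$. A probability measure on $\mathbb{R}^m$ is full if its support is not contained in any proper hyperplane (i.e. affine hyperplane) of $\mathbb{R}^m$. $X$ is proper if for each $t\neq 0$ the distribution of $X(t)$ is full. $X$ is stochastically continuous if it is continuous in probability at every $t\in\mathbb{R}^d$. *)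

(* Defs.v *)
From HB Require Import structures.
From mathcomp Require Import all_boot all_order all_algebra.
From mathcomp Require Import complex.
From mathcomp Require Import all_classical all_reals all_analysis.

Set Implicit Arguments.
Unset Strict Implicit.
Unset Printing Implicit Defensive.

Import Order.TTheory GRing.Theory Num.Theory.
Import numFieldNormedType.Exports.

Local Open Scope classical_set_scope.
Local Open Scope ring_scope.

Section Matrices.
Variable R : realType.

Definition complex_mx n (A : 'M[R]_n) : 'M[R[i]]_n := map_mx (real_complex R) A.

(* [mxminpoly] requires matrices of size [n.+1]. *)
Definition Qmx n (A : 'M[R]_n.+1) : Prop :=
  A \in unitmx /\
  forall z : R[i], eigenvalue (complex_mx A) z -> 0 < complex.Re z.

Definition Mmx n (A : 'M[R]_n.+1) : Prop :=
  forall z : R[i], eigenvalue (complex_mx A) z ->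
    0 <= complex.Re z /\
    (complex.Re z = 0 ->
       mup z (map_poly (real_complex R) (mxminpoly A)) = 1%N).

Definition powmx n (r : R) (A : 'M[R]_n) : 'M[R]_n :=
  limn (series (fun k => (ln r ^+ k / k`!%:R) *: A ^+ k)).

End Matrices.

Section RandomFields.
Context {R : realType} {disp : measure_display} {T : measurableType disp}.
Variable P : probability T R.

(* Matrices with the Borel sigma-algebra of their usual topology. *)
Definition borel_mx (m n : nat) := g_sigma_algebraType (@open 'M[R]_(m, n)).

Definition random_field d m (X : 'cV[R]_d -> T -> 'cV[R]_m) : Prop :=
  forall t, measurable_fun [set: T] (X t : T -> borel_mx m 1).

(* Law of (X(t_1), ..., X(t_k)), as a measure on the m x k matrices whose j-th
   column is the value at t_j. *)
Definition fdd d m (X : 'cV[R]_d -> T -> 'cV[R]_m) k (t : 'I_k -> 'cV[R]_d) :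
    set (borel_mx m k) -> \bar R :=
  pushforward P (fun w => (\matrix_(i, j) X (t j) w i 0) : borel_mx m k).

Definition eq_fdd d m (X Y : 'cV[R]_d -> T -> 'cV[R]_m) : Prop :=
  forall k (t : 'I_k -> 'cV[R]_d) (A : set (borel_mx m k)),
    measurable A -> fdd X t A = fdd Y t A.

Definition oss d m (X : 'cV[R]_d -> T -> 'cV[R]_m) (E : 'M[R]_d) : Prop :=
  forall r : R, 0 < r -> exists B : 'M[R]_m,
    eq_fdd (fun t w => X (powmx r E *m t) w) (fun t w => B *m X t w).

Definition oss_HM d m (X : 'cV[R]_d -> T -> 'cV[R]_m) (E : 'M[R]_d) : Prop :=
  forall r : R, 0 < r -> exists (B : 'M[R]_m) (a : 'cV[R]_m),
    eq_fdd (fun t w => X (powmx r E *m t) w) (fun t w => B *m X t w + a).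

Definition msupport m (mu : set (borel_mx m 1) -> \bar R) : set 'cV[R]_m :=
  [set x | forall U : set 'cV[R]_m, open U -> U x -> (0 < mu U)%E].

Definition hyperplane m (v : 'cV[R]_m) (c : R) : set 'cV[R]_m :=
  [set x | \sum_i v i 0 * x i 0 = c].

Definition full m (mu : set (borel_mx m 1) -> \bar R) : Prop :=
  forall (v : 'cV[R]_m) (c : R), v != 0 -> ~ (msupport mu `<=` hyperplane v c).

Definition proper_field d m (X : 'cV[R]_d -> T -> 'cV[R]_m) : Prop :=
  forall t, t != 0 -> full (pushforward P (X t : T -> borel_mx m 1)).

Definition stochastically_continuous d m (X : 'cV[R]_d -> T -> 'cV[R]_m) :
    Prop :=
  forall (t : 'cV[R]_d) (e : R), 0 < e ->
    P [set w | e <= `|X s w - X t w|] @[s --> t] --> 0%E.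

End RandomFields.

(* Main.v *)
Require Import Defs.
From HB Require Import structures.
From mathcomp Require Import all_boot all_order all_algebra.
From mathcomp Require Import complex.
From mathcomp Require Import all_classical all_reals all_analysis.
From mathcomp Require Import measurable_realfun.
From mathcomp Require Import ring lra zify.

Set Implicit Arguments.
Unset Strict Implicit.
Unset Printing Implicit Defensive.

Import Order.TTheory GRing.Theory Num.Theory.
Import numFieldNormedType.Exports.

Local Open Scope classical_set_scope.
Local Open Scope ring_scope.

(** Given a time exponent [E], call [A] a scaling matrix over the real number [x]
    when the fields [Y (expmx (x *: E) *m t)] and [A *m Y t] have the same
    finite-dimensional laws, where [expmx] is the matrix exponential, so that
    [x = ln r]. The pairs [(A, x)] form a group, because scalings compose and full
    laws make every scaling matrix invertible. Two facts make this group tractable.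
    It is locally bounded over the line: a matrix that sends a full random vector to
    one that is bounded in probability is itself bounded ([linearly_full_bound],
    [scaling_bounded_along]). It is closed, because the field is stochastically
    continuous ([scaling_closed]). Self-similarity says that it lies over the whole
    line.

    Such a group contains a one-parameter subgroup [expmx (x *: D)] over the line
    ([graded_group_exponent]). This is von Neumann's argument for closed linear
    groups: choose elements [A x] over [x], almost as close to [1] as possible, and
    let [x] decrease to [0]. If the distance from [A x] to [1] is of order [x],
    the quotients [(A x - 1) / x] accumulate at some [D], and suitable powers of
    [A x] converge to [expmx (t *: D)], which lies over [t]. Otherwise the normalized
    directions of [A x - 1] accumulate at some [Z] whose whole one-parameter subgroup
    lies over [0], and dividing [A x] by the right element of that subgroup brings it
    much closer to [1] without leaving the fibre, a contradiction.

    The spectrum of [D] is read off from the growth of [expmx (- s *: D)] for large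
    [s]. The eigenvalues of [E] have positive real parts, so [expmx (- s *: E)] tends
    to [0] ([expmx_decay]) and the field at [expmx (- s *: E) *m t] tends in
    probability to its value at the origin. Hence [expmx (- s *: D)] stays bounded,
    which forbids eigenvalues with negative real part and multiple roots of the
    minimal polynomial on the imaginary axis ([Mmx_of_bounded]). It tends to [0]
    exactly when the field vanishes at the origin ([scaling_decay]), and exactly when
    all eigenvalues of [D] have positive real part ([expmx_decay], [Qmx_of_decay]).

    Scalings with a translation become linear once a coordinate equal to [1] is
    added to the field ([homogenize]). The enlarged field is still full for linear
    hyperplanes, so the same argument applies; the exponent obtained has zero first
    row, and the blocks of its one-parameter group are the linear part and the
    translation part ([oss_HM_exponent]). *)


(** * Entrywise norm and convergence of matrices *)

Section MatrixNorm.
Variable R : realType.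

Lemma mx_entry_le_norm m n (A : 'M[R]_(m, n)) i j : `|A i j| <= `|A|.
Proof.
rewrite [leRHS]/Num.norm /= mx_normrE.
exact: (le_bigmax _ (fun x : 'I_m * 'I_n => `|A x.1 x.2|) (i, j)).
Qed.

Lemma mx_norm_le m n (A : 'M[R]_(m, n)) c :
  0 <= c -> (forall i j, `|A i j| <= c) -> `|A| <= c.
Proof.
move=> c0 Ac; rewrite /Num.norm /= mx_normrE.
by apply: bigmax_le => // ij _; exact: Ac.
Qed.

Lemma mx_norm_lt m n (A : 'M[R]_(m, n)) c :
  0 < c -> (forall i j, `|A i j| < c) -> `|A| < c.
Proof.
move=> c0 Ac; rewrite /Num.norm /= mx_normrE.
by apply: bigmax_lt => // ij _; exact: Ac.
Qed.

Lemma norm_mulmx m n p (A : 'M[R]_(m, n)) (B : 'M[R]_(n, p)) :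
  `|A *m B| <= n%:R * `|A| * `|B|.
Proof.
apply: mx_norm_le => [|i j]; first by rewrite !mulr_ge0.
rewrite mxE (le_trans (ler_norm_sum _ _ _)) //.
rewrite -mulrA mulr_natl -[X in _ *+ X](card_ord n) -sumr_const.
apply: ler_sum => k _; rewrite normrM.
by rewrite ler_pM // mx_entry_le_norm.
Qed.

Lemma cvg_mxP I (F : set_system I) (FF : Filter F) m n (f : I -> 'M[R]_(m, n))
    (M : 'M[R]_(m, n)) :
  (f @ F --> M) <-> forall i j, (f x i j @[x --> F] --> M i j).
Proof.
split=> [fM i j|fM].
  by apply: (@cvg_comp _ _ _ f (fun A : 'M[R]_(m, n) => A i j) _ _ _ fM);
    exact: coord_continuous.
apply/cvgrPdist_lt => e e0.
have : \forall x \near F, forall ij : 'I_m * 'I_n,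
    `|M ij.1 ij.2 - f x ij.1 ij.2| < e.
  by apply: filter_forall => ij; exact/(cvgrPdist_lt _ _).1.
apply: filterS => x fx; apply: mx_norm_lt => // i j.
by rewrite !mxE; exact: (fx (i, j)).
Qed.

Lemma cvg_mulmx I (F : set_system I) (FF : Filter F) m n p
    (f : I -> 'M[R]_(m, n)) (g : I -> 'M[R]_(n, p))
    (A : 'M[R]_(m, n)) (B : 'M[R]_(n, p)) :
  f @ F --> A -> g @ F --> B -> (f x *m g x) @[x --> F] --> A *m B.
Proof.
move=> /cvg_mxP fA /cvg_mxP gB; apply/cvg_mxP => i j.
under eq_cvg do rewrite mxE.
rewrite mxE; apply: cvg_big => [|k _]; first exact: add_continuous.
exact: cvgM.
Qed.

Lemma cvg0_norm_le I (F : set_system I) (FF : Filter F) m n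
    (f : I -> 'M[R]_(m, n)) (h : I -> R) :
  (\forall i \near F, `|f i| <= h i) -> h @ F --> (0 : R) ->
  f @ F --> (0 : 'M[R]_(m, n)).
Proof.
move=> fh h0; apply/cvgrPdist_lt => e e0.
have /cvgrPdist_lt/(_ _ e0) := h0; apply: filterS2 fh => i fi.
rewrite !sub0r !normrN; apply: le_lt_trans.
exact: le_trans fi (ler_norm _).
Qed.

End MatrixNorm.

(** * The matrix exponential as a compound interest limit *)

Section MatrixExponential.
Variables (R : realType) (n : nat).
Implicit Types (A B Y Z : 'M[R]_n.+1) (c x y : R).

(** The maximum norm is submultiplicative only after multiplication by the size
    of the matrices; the price is that the unit matrix has norm [n.+1]. *)
Definition submult_norm A : R := n.+1%:R * `|A|.

Definition expmx_coeff A : ('M[R]_n.+1)^nat := fun k => k`!%:R^-1 *: A ^+ k.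

Definition expmx A : 'M[R]_n.+1 := limn (series (expmx_coeff A)).

Lemma powmxE r A : powmx r A = expmx (ln r *: A).
Proof.
rewrite /powmx /expmx; congr (limn (series _)).
apply/funext => k; rewrite /expmx_coeff exprZn scalerA.
by rewrite mulrC.
Qed.

Lemma submult_norm_ge0 A : 0 <= submult_norm A.
Proof. by rewrite mulr_ge0. Qed.

Lemma norm_mulmx_submult A B : `|A * B| <= submult_norm A * `|B|.
Proof. exact: norm_mulmx. Qed.

Lemma norm_mx1 : `|1 : 'M[R]_n.+1| = 1.
Proof.
apply/eqP; rewrite eq_le; apply/andP; split.
  apply: mx_norm_le => // i j; rewrite mxE; case: (i == j);
    by rewrite ?normr1 ?normr0.
by have := mx_entry_le_norm (1 : 'M[R]_n.+1) 0 0; rewrite mxE eqxx normr1.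
Qed.

Lemma norm_exprmx A k c : submult_norm A <= c -> `|A ^+ k| <= c ^+ k.
Proof.
move=> Ac; have c0 := le_trans (submult_norm_ge0 A) Ac.
elim: k => [|k IH]; first by rewrite !expr0 norm_mx1.
rewrite !exprS (le_trans (norm_mulmx_submult _ _)) //.
by rewrite ler_pM // submult_norm_ge0.
Qed.

Lemma norm_expmx_coeff A k c :
  submult_norm A <= c -> `|expmx_coeff A k| <= exp_coeff c k.
Proof.
move=> Ac; rewrite /expmx_coeff /exp_coeff /= mx_normZ mulrC ger0_norm //.
by rewrite ler_wpM2r // norm_exprmx.
Qed.

Lemma cvg_expmx A : series (expmx_coeff A) @ \oo --> expmx A.
Proof.
suff : exists B : 'M[R]_n.+1, series (expmx_coeff A) @ \oo --> B.
  by move=> [B]; rewrite /expmx => /[dup] /cvg_lim ->.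
exists (\matrix_(i, j) limn (series (fun k => expmx_coeff A k i j))).
apply/cvg_mxP => i j; rewrite mxE.
rewrite (_ : (fun k => _) = series (fun k => expmx_coeff A k i j)); last first.
  by apply/funext => k; rewrite /series /= summxE.
apply: normed_cvg.
apply: (series_le_cvg _ _ _ (is_cvg_series_exp_coeff (submult_norm A))).
- by move=> k /=.
- by move=> k; apply: exp_coeff_ge0; exact: submult_norm_ge0.
- move=> k /=; apply: le_trans (mx_entry_le_norm _ _ _) _.
  exact: norm_expmx_coeff.
Qed.

Lemma series_exp_le c m : 0 <= c -> series (exp_coeff c) m <= expR c.
Proof.
move=> c0; rewrite /expR; apply: nondecreasing_cvgn_le.
  by apply: nondecreasing_series => k _ _; exact: exp_coeff_ge0.
exact: is_cvg_series_exp_coeff.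
Qed.

Lemma norm_expr_sub A B k c :
  submult_norm A <= c -> submult_norm B <= c ->
  `|A ^+ k - B ^+ k| <= k%:R * c ^+ k.-1 * submult_norm (A - B).
Proof.
move=> Ac Bc; have c0 := le_trans (submult_norm_ge0 A) Ac.
elim: k => [|k IH]; first by rewrite !expr0 subrr normr0 !mul0r.
have -> : A ^+ k.+1 - B ^+ k.+1 = A * (A ^+ k - B ^+ k) + (A - B) * B ^+ k.
  by rewrite !exprS mulrBr mulrBl addrA subrK.
apply: le_trans (ler_normD _ _) _.
rewrite -natr1 !mulrDl mul1r /= lerD //; last first.
  rewrite -mulrDl (le_trans (norm_mulmx_submult _ _)) // mulrC.
  by rewrite ler_wpM2r ?submult_norm_ge0 // norm_exprmx.
rewrite (le_trans (norm_mulmx_submult _ _)) //.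
rewrite (le_trans (ler_pM _ _ Ac IH)) ?submult_norm_ge0 //.
case: k {IH} => [|k]; first by rewrite !mul0r mulr0.
by rewrite /= !mulrA (mulrC c) -(mulrA _ c) -exprS.
Qed.

(** Termwise, [A ^+ k - B ^+ k] telescopes into [k] products of [k.-1] factors
    bounded by [c] and one factor [A - B]; the factor [k] cancels against the
    factorial, which leaves the exponential series of [c]. *)
Lemma series_expmx_sub A B m c :
  submult_norm A <= c -> submult_norm B <= c ->
  `|series (expmx_coeff A) m - series (expmx_coeff B) m|
    <= expR c * submult_norm (A - B).
Proof.
move=> Ac Bc; have c0 := le_trans (submult_norm_ge0 A) Ac.
case: m => [|m].
  by rewrite /series /= !big_nil subrr normr0 mulr_ge0 ?expR_ge0 ?submult_norm_ge0.
rewrite /series /= -sumrB (le_trans (ler_norm_sum _ _ _)) //.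
rewrite big_nat_recl // /expmx_coeff !expr0 subrr normr0 add0r.
apply: (@le_trans _ _ (series (exp_coeff c) m * submult_norm (A - B))); last first.
  by rewrite ler_wpM2r ?submult_norm_ge0 // series_exp_le.
rewrite /series /= mulr_suml; apply: ler_sum_nat => k _.
rewrite -scalerBr mx_normZ ger0_norm //.
rewrite (le_trans (ler_wpM2l _ (norm_expr_sub k.+1 Ac Bc))) //.
rewrite /exp_coeff /= !mulrA ler_wpM2r ?submult_norm_ge0 //.
rewrite ler_wpM2r // [leRHS]mulrC ler_wpM2r ?exprn_ge0 //.
by rewrite factS natrM invfM mulrAC mulVf ?mul1r // pnatr_eq0.
Qed.

(** The falling factorial [k ^_ j] misses [k ^ j] by a lower order term; this is
    the quantitative form used to compare binomial and exponential coefficients. *)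
Lemma leq_ffact_expn k j : (k ^ j.+1 <= k * (k ^_ j) + j ^ 2 * k ^ j)%N.
Proof.
elim: j => [|j IH]; first by rewrite expn1 ffactn0 muln1 leq_addr.
have [jk|kj] := leqP j k; last first.
  rewrite -[leqLHS]add0n leq_add // (expnS k j.+1) leq_mul //.
  by rewrite (leq_trans (ltnW kj)) // (leq_trans (leqnSn j)) // -mulnn leq_pmulr.
have fk : (k ^_ j <= k ^ j)%N.
  by elim: j {IH jk} => // j IH; rewrite ffactnSr expnSr leq_mul // leq_subr.
rewrite ffactnSr.
have -> : (k * (k ^_ j * (k - j)) = k * k ^_ j * k - k * k ^_ j * j)%N.
  by rewrite mulnA mulnBr.
have h1 := leq_mul IH (leqnn k).
have h2 : (k * k ^_ j * j <= k ^ j.+1 * j)%N by rewrite leq_mul2r expnS leq_mul2l fk !orbT.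
have h3 : (k * k ^_ j * j <= k * k ^_ j * k)%N by rewrite leq_mul2l jk orbT.
have e1 : (k ^ j.+2 = k ^ j.+1 * k)%N by rewrite -expnSr.
have e2 : (k ^ j.+1 = k ^ j * k)%N by rewrite -expnSr.
nia.
Qed.

Lemma binomial_coeff_gap k j : (0 < k)%N ->
  0 <= (j`!%:R^-1 - 'C(k, j)%:R / k%:R ^+ j : R) <= 4 ^+ j / (k%:R * j`!%:R).
Proof.
move=> k0.
have kR : 0 < k%:R :> R by rewrite ltr0n.
have fR : 0 < j`!%:R :> R by rewrite ltr0n fact_gt0.
have kj : 0 < k%:R ^+ j :> R by rewrite exprn_gt0.
have -> : 'C(k, j)%:R / k%:R ^+ j = (k ^_ j)%:R / (j`!%:R * k%:R ^+ j) :> R.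
  by rewrite -bin_ffact natrM invfM mulrA mulfK // gt_eqF.
have -> : j`!%:R^-1 - (k ^_ j)%:R / (j`!%:R * k%:R ^+ j)
    = (k%:R * (k%:R ^+ j - (k ^_ j)%:R)) / (k%:R * j`!%:R * k%:R ^+ j) :> R.
  by field; rewrite ?gt_eqF.
have ffk : (k ^_ j <= k ^ j)%N.
  by elim: (j) => // i IH; rewrite ffactnSr expnSr leq_mul // leq_subr.
apply/andP; split.
  by rewrite divr_ge0 // mulr_ge0 // subr_ge0 -natrX ler_nat.
rewrite ler_pdivrMr ?mulr_gt0 //.
have -> : 4 ^+ j / (k%:R * j`!%:R) * (k%:R * j`!%:R * k%:R ^+ j)
    = 4 ^+ j * k%:R ^+ j :> R by field; rewrite ?gt_eqF.
rewrite mulrBr lerBlDr -exprS -!natrX -!natrM -natrD ler_nat.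
rewrite (leq_trans (leq_ffact_expn _ _)) // addnC leq_add2r leq_mul2r.
by rewrite -[4%N]/((2 ^ 2)%N) -expnM mulnC expnM leq_sqr (ltnW (ltn_expl _ _)) ?orbT.
Qed.

(** The binomial coefficients of [(1 + Y) ^+ k], written in powers of [k *: Y],
    are below those of the exponential series by a relative error
    [j ^ 2 / k <= 4 ^ j / k], so the error sums to a multiple of [1 / k]. *)
Lemma binomial_expmx_gap Y k c : (0 < k)%N -> submult_norm (k%:R *: Y) <= c ->
  `|(1 + Y) ^+ k - series (expmx_coeff (k%:R *: Y)) k.+1| <= expR (4 * c) / k%:R.
Proof.
move=> k0 Yc; have c0 := le_trans (submult_norm_ge0 _) Yc.
have kR : 0 < k%:R :> R by rewrite ltr0n.
set W := k%:R *: Y.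
have YW : Y = k%:R^-1 *: W by rewrite scalerA mulVf ?scale1r // gt_eqF.
have -> : (1 + Y) ^+ k = \sum_(0 <= j < k.+1) ('C(k, j)%:R / k%:R ^+ j) *: W ^+ j.
  rewrite exprDn_comm; last by rewrite /GRing.comm mul1r mulr1.
  rewrite big_mkord; apply: eq_bigr => j _.
  by rewrite expr1n mul1r {1}YW exprZn exprVn -scaler_nat scalerA.
rewrite /series /= -sumrB (le_trans (ler_norm_sum _ _ _)) //.
apply: (@le_trans _ _ (series (exp_coeff (4 * c)) k.+1 / k%:R)); last first.
  by rewrite ler_wpM2r ?invr_ge0 // series_exp_le // mulr_ge0.
rewrite /series /= mulr_suml; apply: ler_sum_nat => j _.
rewrite /expmx_coeff -scalerBl mx_normZ -opprB normrN.
have /andP[g0 g1] := binomial_coeff_gap j k0.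
rewrite ger0_norm //.
rewrite (le_trans (ler_pM g0 _ g1 (norm_exprmx j Yc))) //.
rewrite /exp_coeff /= exprMn invfM.
by rewrite le_eqVlt; apply/orP; left; apply/eqP; ring.
Qed.

Lemma cvg_submult_norm I (F : set_system I) (FF : Filter F) (f : I -> 'M[R]_n.+1) A :
  f @ F --> A -> submult_norm (f x) @[x --> F] --> submult_norm A.
Proof.
move=> fA; rewrite /submult_norm; apply: cvgM; first exact: cvg_cst.
exact: cvg_norm.
Qed.

(** This limit carries the whole theory of the exponential below: it yields the
    addition formula, and it is the form in which powers of group elements close to
    [1] converge to a one-parameter subgroup. *)
Lemma cvg_compound I (F : set_system I) (FF : ProperFilter F)
    (Y : I -> 'M[R]_n.+1) (k : I -> nat) Z :
  k @ F --> \oo -> (k i)%:R *: Y i @[i --> F] --> Z ->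
  (1 + Y i) ^+ k i @[i --> F] --> expmx Z.
Proof.
move=> koo YZ; pose W i := (k i)%:R *: Y i.
pose c := submult_norm Z + 1.
have nearc : \forall i \near F, submult_norm (W i) <= c.
  have /cvgrPdist_lt/(_ _ ltr01) := cvg_submult_norm FF YZ.
  apply: filterS => i; rewrite distrC ltr_distl => /andP[_ /ltW]; exact.
have Zc : submult_norm Z <= c by rewrite lerDl.
have cvgk : (series (expmx_coeff Z) \o S) (k i) @[i --> F] --> expmx Z.
  apply: (cvg_comp _ _ koo); have := @cvg_expmx Z.
  by rewrite -(cvg_shiftS (series (expmx_coeff Z))).
have kinv : (k i)%:R^-1 @[i --> F] --> (0 : R).
  apply: (@cvg_comp _ _ _ k (fun m => m%:R^-1 : R) _ _ _ koo).
  by apply/gtr0_cvgV0; [near=> m; rewrite ltr0n; near: m; exact: nbhs_infty_gt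
    | exact: cvgr_idn].
(* The power is compared with the partial sum of the series at [W i], and that
   partial sum with the one at [Z]. *)
have d1 : (1 + Y i) ^+ k i - series (expmx_coeff (W i)) (k i).+1
    @[i --> F] --> (0 : 'M[R]_n.+1).
  apply: (@cvg0_norm_le _ _ _ _ _ _ _ (fun i => expR (4 * c) * (k i)%:R^-1)).
  - apply: filterS2 nearc (koo _ (nbhs_infty_gt 0)) => x Wc kx.
    exact: binomial_expmx_gap.
  - by rewrite -(mulr0 (expR (4 * c))); apply: cvgM => //; exact: cvg_cst.
have d2 : series (expmx_coeff (W i)) (k i).+1 - series (expmx_coeff Z) (k i).+1
    @[i --> F] --> (0 : 'M[R]_n.+1).
  apply: (@cvg0_norm_le _ _ _ _ _ _ _ (fun i => expR c * submult_norm (W i - Z))).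
  - apply: filterS nearc => x Wc; exact: series_expmx_sub.
  - rewrite -(mulr0 (expR c)); apply: cvgM; first exact: cvg_cst.
    have -> : 0 = submult_norm (Z - Z) by rewrite subrr /submult_norm normr0 mulr0.
    by apply: cvg_submult_norm; apply: cvgB => //; exact: cvg_cst.
have h := cvgD (cvgD d1 d2) cvgk.
rewrite -[expmx Z]add0r -[X in X + expmx Z]addr0.
apply: (cvg_trans _ (h _ _)).
by apply: near_eq_cvg; near=> x; rewrite !fctE /= addrA subrK subrK.
Unshelve. all: by end_near. Qed.

(** When [A] and [B] commute, [(1 + A / k) ^+ k * (1 + B / k) ^+ k] is the [k]-th
    power of [1 + (A + B) / k + A * B / k ^ 2], and the last term does not affect
    the compound interest limit. *)
Lemma expmxD A B : A * B = B * A -> expmx (A + B) = expmx A * expmx B.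
Proof.
move=> AB.
have inv0 : (k.+1%:R^-1 : R) @[k --> \oo] --> (0 : R).
  exact: cvg_harmonic.
have Soo : S @ \oo --> \oo by under eq_cvg do rewrite -addn1; exact: cvg_addnr.
have kk (k : nat) : k.+1%:R != 0 :> R by rewrite pnatr_eq0.
have cA : (1 + k.+1%:R^-1 *: A) ^+ k.+1 @[k --> \oo] --> expmx A.
  apply: (cvg_compound _ (k := S)) => //.
  under eq_cvg do rewrite scalerA divff // scale1r.
  exact: cvg_cst.
have cB : (1 + k.+1%:R^-1 *: B) ^+ k.+1 @[k --> \oo] --> expmx B.
  apply: (cvg_compound _ (k := S)) => //.
  under eq_cvg do rewrite scalerA divff // scale1r.
  exact: cvg_cst.
have cAB : (1 + (k.+1%:R^-1 *: (A + B) + (k.+1%:R^-1 ^+ 2) *: (A * B))) ^+ k.+1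
    @[k --> \oo] --> expmx (A + B).
  apply: (cvg_compound _ (k := S)) => //.
  under eq_cvg do rewrite scalerDr !scalerA divff // scale1r expr2 mulrA divff // mul1r.
  have := cvgD (cvg_cst (A + B)) (cvgZr_tmp (a := A * B) inv0).
  by rewrite scale0r addr0 => h; exact: h.
apply: (cvg_unique _ cAB) => //.
rewrite -mulmxE.
apply: (cvg_trans _ (cvg_mulmx _ cA cB)).
apply: near_eq_cvg; near=> k.
rewrite /= mulmxE -exprMn_comm; last first.
  rewrite /GRing.comm; apply: GRing.commrD; first exact: GRing.commr1.
  apply: GRing.commr_sym; apply: GRing.commrD; first exact: GRing.commr1.
  by rewrite /GRing.comm -!scalerAl -!scalerAr AB !scalerA mulrC.
congr (_ ^+ _).
rewrite mulrDl mul1r mulrDr mulr1 scalerDr -scalerAl -scalerAr scalerA.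
by rewrite expr2 -!addrA; congr (_ + _); rewrite addrCA.
Unshelve. all: by end_near. Qed.

End MatrixExponential.

(** * Derivative of the matrix exponential *)

Section ExponentialDerivative.
Variables (R : realType) (n : nat).
Implicit Types (A B Y Z : 'M[R]_n.+1) (c x y : R).

Lemma expmx0 : expmx (0 : 'M[R]_n.+1) = 1.
Proof.
have h : (1 + (0 : 'M[R]_n.+1)) ^+ k @[k --> \oo] --> expmx (0 : 'M[R]_n.+1).
  apply: (cvg_compound _ (k := id) (Y := fun=> 0)) => //.
  under eq_cvg do rewrite scaler0.
  exact: cvg_cst.
have h1 : (1 + (0 : 'M[R]_n.+1)) ^+ k @[k --> \oo] --> (1 : 'M[R]_n.+1).
  by under eq_cvg do rewrite addr0 expr1n; exact: cvg_cst.
exact: (cvg_unique _ h h1).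
Qed.

Lemma expmxZD A x y : expmx ((x + y) *: A) = expmx (x *: A) * expmx (y *: A).
Proof.
by rewrite scalerDl expmxD // -!scalerAl -!scalerAr !scalerA mulrC.
Qed.

Lemma expmxZN A x : expmx (x *: A) * expmx (- x *: A) = 1.
Proof. by rewrite -expmxZD subrr scale0r expmx0. Qed.

Lemma norm_expmx_sub1 A c : submult_norm A <= c ->
  `|expmx A - 1 - A| <= c ^+ 2 * expR c.
Proof.
move=> Ac; have c0 := le_trans (submult_norm_ge0 A) Ac.
have h : `|series (expmx_coeff A) m - 1 - A| @[m --> \oo] --> `|expmx A - 1 - A|.
  apply: cvg_norm; apply: cvgB; last exact: cvg_cst.
  by apply: cvgB; [exact: cvg_expmx | exact: cvg_cst].
rewrite -(cvg_shiftn 2 _ _) in h.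
apply: (ler_cvg_to h (cvg_cst (c ^+ 2 * expR c))).
near=> m.
rewrite /= addn2.
have -> : series (expmx_coeff A) m.+2 - 1 - A
    = \sum_(0 <= i < m) (i.+2)`!%:R^-1 *: A ^+ i.+2.
  rewrite /series /= !big_nat_recl // /expmx_coeff expr0 expr1.
  by rewrite invr1 !scale1r [1 + _]addrC addrK [A + _]addrC addrK.
apply: le_trans (ler_norm_sum _ _ _) _.
apply: (@le_trans _ _ (c ^+ 2 * series (exp_coeff c) m)); last first.
  by rewrite ler_wpM2l ?exprn_ge0 // series_exp_le.
rewrite /series /= mulr_sumr; apply: ler_sum_nat => k _.
apply: le_trans (norm_expmx_coeff k.+2 Ac) _.
rewrite /exp_coeff /= mulrA -exprD add2n ler_wpM2l ?exprn_ge0 //.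
by rewrite lef_pV2 ?posrE ?ltr0n ?fact_gt0 // ler_nat !factS mulnA leq_pmull // muln_gt0.
Unshelve. all: by end_near. Qed.

Lemma cvg_expmx_slope A I (F : set_system I) (FF : Filter F) (h : I -> R) :
  h @ F --> (0 : R) -> (\forall i \near F, h i != 0) ->
  (h i)^-1 *: (expmx (h i *: A) - 1) @[i --> F] --> A.
Proof.
move=> h0 hn0.
pose C := submult_norm A ^+ 2 * expR (submult_norm A).
have h1 : (h i)^-1 *: (expmx (h i *: A) - 1) - A @[i --> F] --> (0 : 'M[R]_n.+1).
  apply: (@cvg0_norm_le _ _ _ _ _ _ _ (fun i => C * `|h i|)).
    have /cvgrPdist_le/(_ _ ltr01) := h0.
    apply: filterS2 hn0 => i hi; rewrite sub0r normrN => hi1.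
    rewrite -[X in _ - X](scale1r A) -(mulVf hi) -scalerA -scalerBr mx_normZ.
    have hA : submult_norm (h i *: A) <= `|h i| * submult_norm A.
      by rewrite /submult_norm mx_normZ mulrCA.
    apply: le_trans (ler_wpM2l _ (norm_expmx_sub1 hA)) _ => //.
    rewrite normfV ler_pdivrMl ?normr_gt0 //.
    have -> : `|h i| * (C * `|h i|)
        = (`|h i| * submult_norm A) ^+ 2 * expR (submult_norm A) by rewrite /C; ring.
    rewrite ler_wpM2l ?sqr_ge0 // ler_expR.
    by rewrite ler_piMl // submult_norm_ge0.
  rewrite -(mulr0 C); apply: cvgM; first exact: cvg_cst.
  by rewrite -(normr0 R); exact: cvg_norm.
have h2 := cvgD h1 (cvg_cst A); rewrite -[X in _ --> X]add0r.
apply: (cvg_trans _ (h2 _ _)); apply: near_eq_cvg; apply: nearW => i.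
by rewrite !fctE /= subrK.
Qed.

Lemma is_derive_row_expmx (u : 'rV[R]_n.+1) A j x :
  is_derive x (1 : R) (fun s => (u *m expmx (s *: A)) 0 j)
    ((u *m A *m expmx (x *: A)) 0 j).
Proof.
have cv : h^-1 *: (((fun s => (u *m expmx (s *: A)) 0 j) \o shift x) (h *: (1 : R))
    - (u *m expmx (x *: A)) 0 j) @[h --> (0 : R)^'] -->
    ((u *m A *m expmx (x *: A)) 0 j : R).
  have c1 : u *m (h^-1 *: (expmx (h *: A) - 1)) *m expmx (x *: A)
      @[h --> (0:R)^'] --> u *m A *m expmx (x *: A).
    apply: cvg_mulmx; last exact: cvg_cst.
    apply: cvg_mulmx; first exact: cvg_cst.
    apply: cvg_expmx_slope.
      by apply: cvg_within_filter; exact: cvg_id.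
    by near=> h; near: h; exact: nbhs_dnbhs_neq.
  apply: (cvg_trans _ ((cvg_mxP _ _ _).1 c1 0 j)).
  apply: near_eq_cvg; apply: nearW => h /=.
  rewrite -scalemxAr -scalemxAl mxE /shift /= [h *: 1]mulr1 expmxZD.
  by rewrite mulmxBr mulmx1 mulmxBl -mulmxA mulmxE !mxE.
apply: DeriveDef; first by apply/cvg_ex; eexists; exact: cv.
exact: cvg_lim cv.
Unshelve. all: by end_near. Qed.

Lemma cvg_expmx_scale A x : expmx (s *: A) @[s --> x] --> expmx (x *: A).
Proof.
apply/cvg_mxP => i j.
have E (s : R) : expmx (s *: A) i j = ((delta_mx 0 i : 'rV[R]_n.+1) *m expmx (s *: A)) 0 j.
  rewrite mxE (bigD1 i) //= mxE !eqxx mul1r big1 ?addr0 // => k ki.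
  by rewrite mxE (negbTE ki) andbF mul0r.
rewrite E; under eq_cvg do rewrite E.
have [+ _] := is_derive_row_expmx (delta_mx 0 i) A j x.
by move=> /derivable1_diffP/differentiable_continuous.
Qed.

End ExponentialDerivative.

(** * Filters and ultrafilters *)

Lemma cvg_invr_pinfty (R : realType) I (F : set_system I) (FF : Filter F)
    (f : I -> R) :
  f @ F --> (0 : R) -> (\forall i \near F, 0 < f i) ->
  (f i)^-1 @[i --> F] --> +oo.
Proof.
move=> f0 fpos; apply/cvgryPge => a.
have a0 : 0 < (`|a| + 1)^-1 by rewrite invr_gt0 ltr_wpDl.
have /cvgrPdist_lt/(_ _ a0) := f0; apply: filterS2 fpos => i fi.
rewrite sub0r normrN gtr0_norm // => fa.
rewrite (le_trans (ler_norm a)) // (@le_trans _ _ (`|a| + 1)) ?lerDl //.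
by rewrite -[leLHS]invrK lef_pV2 ?posrE // ltW.
Qed.

Lemma ultra_fmap T U (F : set_system T) (f : T -> U) :
  UltraFilter F -> UltraFilter (f @ F).
Proof.
move=> FU; have FF := @ultra_proper _ F FU; split; first exact: fmap_proper_filter.
move=> G GF sFG; apply/seteqP; split=> A; last exact: sFG.
move=> GA; have [//|nA] := in_ultra_setVsetC (f @^-1` A) FU.
have GnA : G (~` A) by apply: sFG.
by have [x [/[swap] h /h]] := filter_ex (filterI GA GnA).
Qed.

(** Bounded sets of matrices are relatively compact, so ultrafilters spare the
    extraction of subsequences. *)
Lemma ultra_bounded_cvg (R : realType) m n I (F : set_system I)
    (f : I -> 'M[R]_(m, n)) c :
  UltraFilter F -> (\forall i \near F, `|f i| <= c) ->
  exists A : 'M[R]_(m, n), f @ F --> A.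
Proof.
move=> FU fc; have FF := @ultra_proper _ F FU.
suff h i j : exists y : R, f x i j @[x --> F] --> y.
  exists (\matrix_(i, j) get [set y : R | f x i j @[x --> F] --> y]).
  apply/cvg_mxP => i j; rewrite mxE.
  by have [y hy] := h i j; exact: (@getI _ [set y : R | f x i j @[x --> F] --> y] y hy).
have := @segment_compact R (- c) c; rewrite compact_ultra.
move=> /(_ ((fun x => f x i j) @ F) (ultra_fmap _ FU)) [].
  apply: filterS fc => x /=; rewrite in_itv /= -ler_norml; apply: le_trans.
  exact: mx_entry_le_norm.
by move=> y [_ hy]; exists y.
Qed.

(** * One-parameter subgroups of closed groups of matrices fibred over the line *)

Section GradedGroup.
(** [H x] is the fibre over [x] of a subgroup of the product of the invertible
    matrices by the real line, and [H_closed] says that this subgroup is closed. *)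
Variables (R : realType) (n : nat) (H : R -> set 'M[R]_n.+1).
Implicit Types (A B Z : 'M[R]_n.+1) (x y t : R).

Hypothesis H_neq0 : forall x, H x !=set0.
Hypothesis H_mul : forall x y A B, H x A -> H y B -> H (x + y) (A * B).
Hypothesis H_inv : forall x A, H x A -> A \is a GRing.unit /\ H (- x) A^-1.
Hypothesis H_bounded : exists c, \forall x \near (0 : R), forall A, H x A -> `|A| <= c.
Hypothesis H_closed : forall x A,
  (forall e, 0 < e -> exists y B, [/\ H y B, `|x - y| < e & `|A - B| < e]) -> H x A.

Lemma graded_closed I (F : set_system I) (FF : ProperFilter F)
    (f : I -> R) (g : I -> 'M[R]_n.+1) x A :
  f @ F --> x -> g @ F --> A -> (\forall i \near F, H (f i) (g i)) -> H x A.
Proof.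
move=> fx gA Hfg; apply: H_closed => e e0.
have /cvgrPdist_lt/(_ _ e0) fe := fx.
have /cvgrPdist_lt/(_ _ e0) ge := gA.
have [i [[? ?] ?]] := filter_ex (filterI (filterI fe ge) Hfg).
by exists (f i), (g i).
Qed.

Lemma graded_1 : H 0 1.
Proof.
have [A HA] := H_neq0 0; have [uA HAV] := H_inv HA.
by have := H_mul HA HAV; rewrite subrr mulrV.
Qed.

Lemma graded_exp x A k : H x A -> H (k%:R * x) (A ^+ k).
Proof.
move=> HA; elim: k => [|k IH]; first by rewrite mul0r expr0; exact: graded_1.
by rewrite -natr1 mulrDl mul1r exprSr; exact: H_mul.
Qed.

(** Von Neumann's observation: if the elements [1 + Y i] tend to [1] in the
    direction [Z], at the rate [1 / l i], then their powers of exponent about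
    [t * l i] stay in the group and tend to [expmx (t *: Z)]. *)
Lemma graded_one_parameter I (F : set_system I) (FF : ProperFilter F)
    (Y : I -> 'M[R]_n.+1) (x l : I -> R) Z xi :
  l @ F --> +oo -> l i *: Y i @[i --> F] --> Z -> l i * x i @[i --> F] --> xi ->
  (\forall i \near F, H (x i) (1 + Y i)) ->
  forall t, H (t * xi) (expmx (t *: Z)).
Proof.
move=> loo lY lx HY.
have pos t : 0 < t -> H (t * xi) (expmx (t *: Z)).
  move=> t0; pose k i := Num.truncn (t * l i).
  have l1 : \forall i \near F, t^-1 <= l i by move/cvgryPge : loo; exact.
  have kt : (k i)%:R / l i @[i --> F] --> t.
    have linv : (l i)^-1 @[i --> F] --> (0 : R).
      apply/gtr0_cvgV0 => //; apply: filterS l1 => i; apply: lt_le_trans.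
      by rewrite invr_gt0.
    have tl : t - (l i)^-1 @[i --> F] --> t.
      rewrite -[X in _ --> X]subr0; apply: cvgB; [exact: cvg_cst|exact: linv].
    apply: (squeeze_cvgr _ tl (cvg_cst t)).
    apply: filterS l1 => i li.
    have l0 : 0 < l i by apply: lt_le_trans li; rewrite invr_gt0.
    have /andP[k1 k2] := truncn_itv (mulr_ge0 (ltW t0) (ltW l0)).
    rewrite ler_pdivrMr // k1 andbT ler_pdivlMr // mulrBl mulVf ?gt_eqF //.
    by rewrite lerBlDr natr1 ltW.
  have koo : k @ F --> \oo.
    apply/(@cvgrnyP R); apply/cvgryPge => a.
    have : \forall i \near F, (a + 1) / t <= l i by move/cvgryPge : loo; exact.
    apply: filterS => i; rewrite ler_pdivrMr // mulrC => ai.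
    have := truncnS_gt (t * l i); rewrite -natr1 -/(k i) => /ltW.
    by move/(le_trans ai); rewrite lerD2r.
  have l0 : \forall i \near F, l i != 0.
    by apply: filterS l1 => i li; rewrite gt_eqF // (lt_le_trans _ li) // invr_gt0.
  apply: (@graded_closed _ F FF (fun i => (k i)%:R * x i) (fun i => (1 + Y i) ^+ k i)).
  - apply: (cvg_trans _ (cvgM kt lx)); apply: near_eq_cvg.
    by apply: filterS l0 => i li; rewrite /= mulrA divfK.
  - apply: cvg_compound => //.
    apply: (cvg_trans _ (cvgZ kt lY)); apply: near_eq_cvg.
    by apply: filterS l0 => i li; rewrite scalerA divfK.
  - by apply: filterS HY => i; exact: graded_exp.
move=> t; have [t0|t0|->] := ltgtP t 0.
- have Nt : 0 < - t by rewrite oppr_gt0.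
  have [_] := H_inv (pos _ Nt); rewrite mulNr opprK.
  suff -> : (expmx (- t *: Z))^-1 = expmx (t *: Z) by [].
  have e1 := expmxZN Z t; have e2 := expmxZN Z (- t).
  rewrite opprK in e2.
  apply: (mulrI (H_inv (pos _ Nt)).1); rewrite mulrV ?(H_inv (pos _ Nt)).1 //.
- exact: pos.
- by rewrite mul0r scale0r expmx0; exact: graded_1.
Qed.

(** The factor [2] leaves room for an infimum of the distances to [1] that is not
    reached; when that infimum is [0], closedness puts [1] itself in the fibre. *)
Lemma graded_near_minimizer x :
  exists2 A, H x A & forall B, H x B -> `|A - 1| <= 2 * `|B - 1|.
Proof.
have [H1|nH1] := pselect (H x 1).
  by exists 1 => // B _; rewrite subrr normr0 mulr_ge0.
pose E := [set `|B - 1| | B in H x].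
have E0 : has_lbound E by exists 0 => _ [B _ <-].
have infE : has_inf E.
  by split=> //; have [A HA] := H_neq0 x; exists `|A - 1|; exists A.
have d0 : 0 < inf E.
  rewrite lt_neqAle lb_le_inf ?andbT //; last first.
  - by move=> _ [B _ <-].
  - by case: infE.
  apply/eqP => d0; apply: nH1; apply: H_closed => e e0.
  have [_ [B HB <-]] := inf_adherent e0 infE.
  by rewrite -d0 add0r => Be; exists x, B; rewrite subrr normr0 distrC.
have [_ [A HA <-] Ad] := inf_adherent d0 infE.
exists A => // B HB; rewrite (le_trans (ltW Ad)) //.
have : inf E <= `|B - 1| by apply: ge_inf => //; exists B.
lra.
Qed.

(** Take near-minimizers [1 + Y x] of the distance to [1] over [x], and let [x]
    decrease to [0]. If [Y x] is of order [x], then [Y x / x] accumulates at an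
    exponent. Otherwise the directions of [Y x] accumulate at some [Z] whose
    one-parameter subgroup lies entirely over [0]; then the product of [1 + Y x] by
    [expmx (- `|Y x| *: Z)] is in the same fibre and at distance [o(`|Y x|)] from
    [1], which a near-minimizer excludes. *)
Lemma graded_group_exponent : exists D, forall x, H x (expmx (x *: D)).
Proof.
pose A x := projT1 (cid2 (graded_near_minimizer x)).
have HA x : H x (A x) by rewrite /A; case: cid2.
have Amin x B : H x B -> `|A x - 1| <= 2 * `|B - 1|.
  by rewrite /A; case: cid2 => /= A' _; exact.
pose Y x := A x - 1.
have HY x : H x (1 + Y x) by rewrite /Y addrC subrK.
(* An ultrafilter refining the right neighbourhoods of [0], along which bounded
   functions converge. *)
have [F [FU sF]] := ultraFilterLemma (at_right_proper_filter (0 : R)).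
have FF : ProperFilter F := @ultra_proper _ F FU.
have HYF : \forall x \near F, H x (1 + Y x) by exact: nearW.
have F0 : x @[x --> F] --> (0 : R).
  have c0 : x @[x --> (0 : R)^'+] --> (0 : R).
    by apply: cvg_at_right_filter; exact: cvg_id.
  by move=> U /c0; exact: sF.
have Fgt0 : \forall x \near F, 0 < x by apply: sF; exact: nbhs_right_gt.
have FV : x^-1 @[x --> F] --> +oo by exact: cvg_invr_pinfty.
have [[c Fc]|nFc] := pselect (exists c, \forall x \near F, `|Y x| <= c * x).
  have [D YD] : exists D : 'M[R]_n.+1, (x^-1 *: Y x) @[x --> F] --> D.
    apply: (ultra_bounded_cvg (c := c)) => //.
    apply: filterS2 Fc Fgt0 => x xc x0.
    by rewrite mx_normZ gtr0_norm ?invr_gt0 // ler_pdivrMl // mulrC.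
  have x1 : x^-1 * x @[x --> F] --> (1 : R).
    by apply: cvg_near_cst; apply: filterS Fgt0 => y y0; rewrite mulVf // gt_eqF.
  exists D => x; have := graded_one_parameter FF FV YD x1 HYF x.
  by rewrite mulr1.
have {}nFc c : \forall x \near F, c * x < `|Y x|.
  have [h|] := in_ultra_setVsetC [set x | `|Y x| <= c * x] FU.
    by exfalso; apply: nFc; exists c.
  by apply: filterS => x /= /negP; rewrite -ltNge.
have v0 : \forall x \near F, 0 < `|Y x| by apply: filterS (nFc 0) => x; rewrite mul0r.
(* Arbitrary elements over [x] accumulate at an element [A0] over [0]; dividing
   by it gives elements over [x] that tend to [1]. *)
have vcvg : `|Y x| @[x --> F] --> (0 : R).
  have [c cH] := H_bounded.
  pose A' x := get (H x).
  have HA' x : H x (A' x) by have [B HB] := H_neq0 x; exact: (getI HB).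
  have [A0 A'0] : exists A0 : 'M[R]_n.+1, A' @ F --> A0.
    apply: (ultra_bounded_cvg (c := c)) => //.
    by apply: filterS (F0 _ cH) => x /=; exact.
  have H0 : H 0 A0 by apply: (graded_closed FF F0 A'0); exact: nearW.
  have [uA0 H0V] := H_inv H0.
  have cA : A' x *m A0^-1 - 1 @[x --> F] --> (0 : 'M[R]_n.+1).
    rewrite -(subrr (1 : 'M[R]_n.+1)) -{2}(mulrV uA0); apply: cvgB; last exact: cvg_cst.
    by apply: cvg_mulmx => //; exact: cvg_cst.
  have cA2 : 2 * `|A' x *m A0^-1 - 1| @[x --> F] --> (0 : R).
    rewrite -(mulr0 2); apply: cvgM; first exact: cvg_cst.
    by rewrite -(@normr0 _ 'M[R]_n.+1); exact: cvg_norm.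
  apply: (squeeze_cvgr _ (cvg_cst 0) cA2); apply: nearW => x.
  rewrite normr_ge0 /=; apply: Amin.
  by have := H_mul (HA' x) H0V; rewrite subr0.
have [Z YZ] : exists Z : 'M[R]_n.+1, (`|Y x|^-1 *: Y x) @[x --> F] --> Z.
  apply: (ultra_bounded_cvg (c := 1)) => //.
  apply: filterS v0 => x vx.
  by rewrite mx_normZ normfV normr_id mulVf // gt_eqF.
have vV : `|Y x|^-1 @[x --> F] --> +oo by exact: cvg_invr_pinfty.
have lx0 : `|Y x|^-1 * x @[x --> F] --> (0 : R).
  apply/cvgrPdist_lt => e e0.
  apply: filterS3 (nFc e^-1) v0 Fgt0 => x xe vx x0.
  rewrite sub0r normrN gtr0_norm ?mulr_gt0 ?invr_gt0 //.
  by rewrite ltr_pdivrMl // -ltr_pdivrMr // mulrC.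
have HZ t : H 0 (expmx (t *: Z)).
  have := graded_one_parameter FF vV YZ lx0 HYF t.
  by rewrite mulr0.
have slope : (- `|Y x|)^-1 *: (expmx (- `|Y x| *: Z) - 1) @[x --> F] --> Z.
  apply: cvg_expmx_slope; first by rewrite -oppr0; exact: cvgN.
  by apply: filterS v0 => x vx; rewrite oppr_eq0 gt_eqF.
have Y0 : Y x @[x --> F] --> (0 : 'M[R]_n.+1) by exact: norm_cvg0.
have lim0 : `|Y x|^-1 *: Y x - (1 + Y x) *m ((- `|Y x|)^-1 *: (expmx (- `|Y x| *: Z) - 1))
    @[x --> F] --> (0 : 'M[R]_n.+1).
  rewrite -(subrr Z) -[X in _ - X]mul1r -[X in X * Z]addr0.
  apply: cvgB => //; apply: cvg_mulmx => //.
  by apply: cvgD => //; exact: cvg_cst.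
(* The factor [2] of the near-minimizers fixes the threshold [1 / 2]. *)
have /cvgrPdist_lt/(_ 2^-1) := lim0.
rewrite invr_gt0 ltr0n => /(_ isT) near0.
have [x [hx vx]] := filter_ex (filterI near0 v0).
exfalso; move: hx; apply/negP; rewrite -leNgt sub0r normrN.
rewrite invrN scaleNr mulmxN opprK -scalemxAr -scalerDr mx_normZ normfV normr_id.
have -> : Y x + (1 + Y x) *m (expmx (- `|Y x| *: Z) - 1)
    = (1 + Y x) * expmx (- `|Y x| *: Z) - 1.
  by rewrite mulmxBr mulmx1 mulmxE addrCA opprD (addrCA (Y x)) subrr addr0.
rewrite ler_pdivlMl // mulrC -ler_pdivlMl ?invr_gt0 // invrK.
apply: Amin; have := H_mul (HY x) (HZ (- `|Y x|)).
by rewrite addr0.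
Qed.

End GradedGroup.

(** * Two scalar differential equations *)

Section ScalarODE.
Variable R : realType.
Implicit Types (f g : R -> R) (k c s : R).

Lemma is_derive1_constant_eq f c :
  (forall s, is_derive s (1 : R) f c) -> forall s, f s = f 0 + c * s.
Proof.
move=> df s; apply/eqP; rewrite -subr_eq; apply/eqP.
pose g := fun s => f s - c * s.
have dg x : is_derive x (1 : R) g 0.
  have d1 := df x.
  have : is_derive x (1 : R) (f - (c \*: (id : R -> R))) (c - c *: (1 : R)).
    exact: is_deriveB.
  by rewrite [c *: 1]mulr1 subrr.
have := is_derive_0_is_cst s 0 dg.
by rewrite /g mulr0 subr0.
Qed.

(** The product of [f] by [expR (- k * s)] has derivative zero. *)
Lemma is_derive1_linear_eq f k :
  (forall s, is_derive s (1 : R) f (k * f s)) -> forall s, f s = f 0 * expR (k * s).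
Proof.
move=> df s.
pose g := fun s => f s * expR (- k * s).
have dg x : is_derive x (1 : R) g 0.
  have d1 := df x.
  have d2 : is_derive x (1 : R) (fun s => expR (- k * s)) (- k * expR (- k * x)).
    have d3 : is_derive x (1 : R) (fun s : R => - k * s) (- k).
      have : is_derive x (1 : R) ((- k) \*: (id : R -> R)) (- k *: (1 : R)).
        exact: is_deriveZ.
      by rewrite [_ *: 1]mulr1.
    have d4 : is_derive (- k * x) (1 : R) expR (expR (- k * x)).
      exact: is_derive_expR.
    have := is_derive1_comp d4 d3.
    by move=> h; apply: (is_derive_eq h); exact: mulrC.
  have := is_deriveM d1 d2; rewrite /g => d.
  apply: (is_derive_eq d); rewrite /GRing.scale /=; ring.
have := is_derive_0_is_cst s 0 dg.
rewrite /g mulr0 expR0 mulr1 => <-.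
by rewrite -mulrA -expRD mulNr addNr expR0 mulr1.
Qed.

Lemma is_derive1_sum2 f1 f2 g1 g2 s a1 a2 b1 b2 :
  is_derive s (1 : R) f1 a1 -> is_derive s (1 : R) f2 a2 ->
  is_derive s (1 : R) g1 b1 -> is_derive s (1 : R) g2 b2 ->
  is_derive s (1 : R) (fun s => f1 s * g1 s + f2 s * g2 s)
    (a1 * g1 s + f1 s * b1 + (a2 * g2 s + f2 s * b2)).
Proof.
move=> d1 d2 e1 e2.
apply: (is_derive_eq (is_deriveD (is_deriveM d1 e1) (is_deriveM d2 e2))).
rewrite /GRing.scale /=; ring.
Qed.

End ScalarODE.

(** * Real and imaginary parts of complex matrices *)

Section RealParts.
Variable R : realType.

Local Notation Re := (@complex.Re R).
Local Notation Im := (@complex.Im R).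

Lemma map_Re_mulmx m n p (v : 'M[R[i]]_(m, n)) (D : 'M[R]_(n, p)) :
  map_mx Re (v *m map_mx (real_complex R) D) = map_mx Re v *m D.
Proof.
apply/matrixP => i j; rewrite !mxE raddf_sum; apply: eq_bigr => k _.
by rewrite !mxE; case: (v i k) => a b /=; rewrite mulr0 subr0.
Qed.

Lemma map_Im_mulmx m n p (v : 'M[R[i]]_(m, n)) (D : 'M[R]_(n, p)) :
  map_mx Im (v *m map_mx (real_complex R) D) = map_mx Im v *m D.
Proof.
apply/matrixP => i j; rewrite !mxE raddf_sum; apply: eq_bigr => k _.
by rewrite !mxE; case: (v i k) => a b /=; rewrite mulr0 add0r.
Qed.

Lemma map_Re_scale m n (z : R[i]) (v : 'M[R[i]]_(m, n)) :
  map_mx Re (z *: v) = Re z *: map_mx Re v - Im z *: map_mx Im v.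
Proof.
by apply/matrixP => i j; rewrite !mxE; case: z (v i j) => a b [x y].
Qed.

Lemma map_Im_scale m n (z : R[i]) (v : 'M[R[i]]_(m, n)) :
  map_mx Im (z *: v) = Re z *: map_mx Im v + Im z *: map_mx Re v.
Proof.
by apply/matrixP => i j; rewrite !mxE; case: z (v i j) => a b [x y] /=.
Qed.

Lemma ReIm_neq0 m n (v : 'M[R[i]]_(m, n)) : v != 0 ->
  exists i j, 0 < Re (v i j) ^+ 2 + Im (v i j) ^+ 2.
Proof.
move=> v0; have /existsP[i /existsP[j vij]] : [exists i, exists j, v i j != 0].
  apply: contraNT v0 => /existsPn h; apply/eqP/matrixP => i j.
  by have /existsPn/(_ j)/negPn/eqP -> := h i; rewrite mxE.
exists i, j; rewrite lt_neqAle addr_ge0 ?sqr_ge0 // andbT eq_sym.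
rewrite paddr_eq0 ?sqr_ge0 // !sqrf_eq0.
by apply: contra vij; case: (v i j) => a b /= /andP[/eqP -> /eqP ->].
Qed.

End RealParts.

(** * What the growth of the exponential says about the spectrum *)

Section ExponentialModes.
Variables (R : realType) (n : nat) (D : 'M[R]_n.+1).
Implicit Types (a b g : 'rV[R]_n.+1) (s al be : R).

Local Notation W a j s := ((a *m expmx (s *: - D)) 0 j).

(** The rows [a] and [b] are the real and imaginary parts of an eigenvector of
    [D] for the eigenvalue [al + i be], and the left-hand side is the squared modulus
    of a coordinate of its image under [expmx (- s *: D)]. It satisfies a scalar
    linear equation, which avoids complex exponentials. *)
Lemma expmx_mode_norm a b al be j :
  a *m D = al *: a - be *: b -> b *m D = al *: b + be *: a ->
  forall s, W a j s ^+ 2 + W b j s ^+ 2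
    = (a 0 j ^+ 2 + b 0 j ^+ 2) * expR (- (al *+ 2) * s).
Proof.
move=> aD bD.
pose N s := W a j s * W a j s + W b j s * W b j s.
have dN s : is_derive s (1 : R) N (- (al *+ 2) * N s).
  have da := is_derive_row_expmx a (- D) j s.
  have db := is_derive_row_expmx b (- D) j s.
  apply: (is_derive_eq (is_derive1_sum2 da db da db)).
  rewrite !mulmxN aD bD !mulNmx !mulmxDl mulNmx -!scalemxAl /N.
  by rewrite !mxE; ring.
move=> s; rewrite !expr2 -/(N s) (is_derive1_linear_eq dN).
by rewrite /N !scale0r !expmx0 !mulmx1.
Qed.

(** The rows [v1 + i v2] and [g1 + i g2] form a Jordan chain for the imaginary
    eigenvalue [i be]. The left-hand side is the real part of the product of the
    conjugate of the first image by the second one; the rotation cancels in it, and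
    only the linear growth due to the nilpotent part remains. *)
Lemma expmx_jordan_pairing (v1 v2 g1 g2 : 'rV[R]_n.+1) be j :
  v1 *m D = - be *: v2 -> v2 *m D = be *: v1 ->
  g1 *m D = - be *: g2 + v1 -> g2 *m D = be *: g1 + v2 ->
  forall s, W v1 j s * W g1 j s + W v2 j s * W g2 j s
    = v1 0 j * g1 0 j + v2 0 j * g2 0 j - (v1 0 j ^+ 2 + v2 0 j ^+ 2) * s.
Proof.
move=> v1D v2D g1D g2D.
have V s : W v1 j s ^+ 2 + W v2 j s ^+ 2 = v1 0 j ^+ 2 + v2 0 j ^+ 2.
  rewrite (@expmx_mode_norm v1 v2 0 be).
  - by rewrite mul0rn oppr0 mul0r expR0 mulr1.
  - by rewrite v1D scale0r sub0r scaleNr.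
  - by rewrite v2D scale0r add0r.
pose h s := W v1 j s * W g1 j s + W v2 j s * W g2 j s.
have dh s : is_derive s (1 : R) h (- (v1 0 j ^+ 2 + v2 0 j ^+ 2)).
  have d1 := is_derive_row_expmx v1 (- D) j s.
  have d2 := is_derive_row_expmx v2 (- D) j s.
  have e1 := is_derive_row_expmx g1 (- D) j s.
  have e2 := is_derive_row_expmx g2 (- D) j s.
  apply: (is_derive_eq (is_derive1_sum2 d1 d2 e1 e2)).
  rewrite -(V s) !mulmxN v1D v2D g1D g2D !mulNmx !mulmxDl -!scalemxAl.
  by rewrite !mxE; ring.
move=> s; rewrite -/(h s) (is_derive1_constant_eq dh) mulNr.
by rewrite /h !scale0r !expmx0 !mulmx1.
Qed.

Lemma mode_coord_bound a j s c : `|expmx (- s *: D)| <= c -> `|W a j s| <= n.+1%:R * `|a| * c.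
Proof.
rewrite scaleNr -scalerN => ec.
apply: le_trans (mx_entry_le_norm _ _ _) _.
apply: le_trans (norm_mulmx _ _) _.
by rewrite ler_wpM2l // mulr_ge0.
Qed.

Lemma eigen_modes z : eigenvalue (complex_mx D) z ->
  exists a b j, [/\ a *m D = complex.Re z *: a - complex.Im z *: b,
    b *m D = complex.Re z *: b + complex.Im z *: a & 0 < a 0 j ^+ 2 + b 0 j ^+ 2].
Proof.
move=> /eigenvalueP[v vD v0].
have [i [j vj]] := ReIm_neq0 v0; rewrite ord1 in vj.
exists (map_mx (@complex.Re R) v), (map_mx (@complex.Im R) v), j; split.
- by rewrite -map_Re_mulmx vD map_Re_scale.
- by rewrite -map_Im_mulmx vD map_Im_scale.
- by rewrite !mxE.
Qed.

(** An eigenvalue with negative real part would make [expmx (- s *: D)] grow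
    exponentially on its eigenvector, and a double root on the imaginary axis of the
    minimal polynomial would make it grow linearly on a Jordan chain of length two. *)
Lemma Mmx_of_bounded c :
  (\forall s \near +oo, `|expmx (- s *: D)| <= c) -> Mmx D.
Proof.
move=> bd z ez.
have [a [b [j [aD bD ab]]]] := eigen_modes ez.
have Re0 : 0 <= complex.Re z.
  rewrite leNgt; apply/negP => z0.
  have modes := expmx_mode_norm j aD bD.
  pose K := (n.+1%:R * `|a| * c) ^+ 2 + (n.+1%:R * `|b| * c) ^+ 2.
  have le_K : \forall s \near +oo,
      (a 0 j ^+ 2 + b 0 j ^+ 2) * (1 + - (complex.Re z *+ 2) * s) <= K.
    apply: filterS bd => s bs.
    apply: (@le_trans _ _ ((a 0 j ^+ 2 + b 0 j ^+ 2) * expR (- (complex.Re z *+ 2) * s))).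
      by rewrite ler_wpM2l ?expR_ge1Dx // ltW.
    rewrite -modes -(real_normK (num_real (W a j s))).
    rewrite -(real_normK (num_real (W b j s))).
    by rewrite lerD // lerXn2r ?nnegrE ?mode_coord_bound //; apply: le_trans (mode_coord_bound _ j bs).
  have [s [sK s1]] : exists s,
      (a 0 j ^+ 2 + b 0 j ^+ 2) * (1 + - (complex.Re z *+ 2) * s) <= K /\
      (K / (a 0 j ^+ 2 + b 0 j ^+ 2)) / (- (complex.Re z *+ 2)) < s.
    exact: (filter_ex (filterI le_K (nbhs_pinfty_gt (num_real _)))).
  move: sK; apply/negP; rewrite -ltNge -ltr_pdivrMl //.
  have k0 : 0 < - (complex.Re z *+ 2) by rewrite oppr_gt0 pmulrn_llt0.
  rewrite ltr_pdivrMr // in s1.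
  by rewrite [X in X < _]mulrC [_ * s]mulrC (lt_le_trans s1) // lerDr.
split=> // z0.
set p := map_poly _ _.
have pE : p = mxminpoly (complex_mx D) by rewrite mxminpoly_map.
have p0 : p != 0 by rewrite pE monic_neq0 // mxminpoly_monic.
have rootp : root p z by rewrite pE -eigenvalue_root_min.
apply/eqP; rewrite eqn_leq mup_leq // mup_geq // expr1 dvdp_XsubCl rootp andbT.
apply/negP => /dvdpP[q pq].
(* If [('X - z) ^+ 2 * q] is the minimal polynomial, then [q1] does not
   annihilate [D], and a nonzero row of its value starts a Jordan chain. *)
pose q1 := q * ('X - z%:P).
have q0 : q != 0 by apply: contraNneq p0 => q0; rewrite pq q0 mul0r.
have q1n0 : horner_mx (complex_mx D) q1 != 0.
  rewrite -dvd_mxminpoly -pE; apply: contraL isT => /dvdp_leq.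
  rewrite mulf_neq0 ?polyXsubC_eq0 // => /(_ isT).
  rewrite pq expr2 mulrA -/q1 size_Mmonic ?monicXsubC //; last first.
    by rewrite mulf_neq0 ?polyXsubC_eq0.
  by rewrite size_XsubC addn2 ltnn.
have qD : horner_mx (complex_mx D) q1 =
    horner_mx (complex_mx D) q *m (complex_mx D - z%:M).
  by rewrite /q1 rmorphM rmorphB /= horner_mx_X horner_mx_C.
have q2 : horner_mx (complex_mx D) q1 *m (complex_mx D - z%:M) = 0.
  have : horner_mx (complex_mx D) p = 0 by rewrite pE mx_root_minpoly.
  by rewrite pq expr2 mulrA -/q1 rmorphM rmorphB /= horner_mx_X horner_mx_C.
have [i [k vik]] := ReIm_neq0 q1n0.
set v := row i (horner_mx (complex_mx D) q1).
set g := row i (horner_mx (complex_mx D) q).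
have gD : g *m complex_mx D = z *: g + v.
  by rewrite /v qD row_mul -/g mulmxBr mul_mx_scalar addrC subrK.
have vD : v *m complex_mx D = z *: v.
  apply/eqP; rewrite -subr_eq0 -mul_mx_scalar -mulmxBr.
  by rewrite /v -row_mul q2 row0.
pose v1 := map_mx (@complex.Re R) v; pose v2 := map_mx (@complex.Im R) v.
pose g1 := map_mx (@complex.Re R) g; pose g2 := map_mx (@complex.Im R) g.
set be := complex.Im z.
have h1 : v1 *m D = - be *: v2.
  by rewrite -map_Re_mulmx vD map_Re_scale z0 scale0r sub0r scaleNr.
have h2 : v2 *m D = be *: v1.
  by rewrite -map_Im_mulmx vD map_Im_scale z0 scale0r add0r.
have h3 : g1 *m D = - be *: g2 + v1.
  by rewrite -map_Re_mulmx gD map_mxD /= map_Re_scale z0 scale0r sub0r scaleNr.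
have h4 : g2 *m D = be *: g1 + v2.
  by rewrite -map_Im_mulmx gD map_mxD /= map_Im_scale z0 scale0r add0r.
have pairing := expmx_jordan_pairing k h1 h2 h3 h4.
set q0' := v1 0 k ^+ 2 + v2 0 k ^+ 2 in pairing.
have q0'_gt0 : 0 < q0' by rewrite /q0' /v1 /v2 !mxE.
set w := v1 0 k * g1 0 k + v2 0 k * g2 0 k in pairing.
pose B (u : 'rV[R]_n.+1) := n.+1%:R * `|u| * c.
pose K := B v1 * B g1 + B v2 * B g2.
have le_K : \forall s \near +oo, q0' * s - w <= K.
  apply: filterS bd => s bs.
  have -> : q0' * s - w = - (W v1 k s * W g1 k s + W v2 k s * W g2 k s).
    by rewrite pairing opprB.
  apply: le_trans (ler_norm _) _; rewrite normrN.
  apply: le_trans (ler_normD _ _) _; rewrite !normrM.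
  by rewrite lerD // ler_pM // mode_coord_bound.
have [s [sK s1]] : exists s, q0' * s - w <= K /\ (K + w) / q0' < s.
  exact: (filter_ex (filterI le_K (nbhs_pinfty_gt (num_real _)))).
move: sK; apply/negP; rewrite -ltNge.
by rewrite ltrBrDr -ltr_pdivrMl // mulrC.
Qed.

(** On an eigenvector whose eigenvalue has nonpositive real part,
    [expmx (- s *: D)] does not decrease. *)
Lemma Qmx_of_decay : expmx (- s *: D) @[s --> +oo] --> (0 : 'M[R]_n.+1) -> Qmx D.
Proof.
move=> dec.
have Re_gt0 z : eigenvalue (complex_mx D) z -> 0 < complex.Re z.
  move=> ez; rewrite ltNge; apply/negP => z0.
  have [a [b [j [aD bD ab]]]] := eigen_modes ez.
  have modes := expmx_mode_norm j aD bD.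
  have ctr (u : 'rV[R]_n.+1) : W u j s @[s --> +oo] --> (0 : R).
    have -> : (0 : R) = (u *m (0 : 'M[R]_n.+1)) 0 j by rewrite mulmx0 mxE.
    apply: (cvg_mxP _ _ _).1; apply: cvg_mulmx; first exact: cvg_cst.
    by under eq_cvg do rewrite scalerN -scaleNr.
  have c0 : W a j s * W a j s + W b j s * W b j s @[s --> +oo] --> (0 : R).
    have := cvgD (cvgM (ctr a) (ctr a)) (cvgM (ctr b) (ctr b)).
    by rewrite !mulr0 addr0 => h; exact: h.
  have /cvgrPdist_lt/(_ _ ab) near0 := c0.
  have [s [s1 s2]] := filter_ex (filterI near0 (nbhs_pinfty_ge (num_real (0 : R)))).
  move: s1; apply/negP; rewrite -leNgt sub0r normrN -!expr2 modes.
  rewrite (le_trans _ (ler_norm _)) // ler_peMr ?(ltW ab) //.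
  by rewrite -expR0 ler_expR mulNr oppr_ge0 mulr_le0_ge0 // mulrn_wle0.
split=> //.
apply/negPn/negP => nD.
have : eigenvalue (complex_mx D) 0.
  by rewrite /eigenvalue /eigenspace raddf0 subr0 kermx_eq0 row_free_unit map_unitmx.
by move=> /Re_gt0; rewrite ltxx.
Qed.

End ExponentialModes.

(** * Decay of the exponential from the spectrum *)

Section Decay.
Variable R : realType.

Local Notation RC := (real_complex R).

(** For small [h], the squared modulus of [1 - h * z] is [1 - 2 h Re z] up to a
    term of order [h ^ 2]. *)
Lemma euler_step_contraction (z : R[i]) : 0 < complex.Re z ->
  exists2 h0 : R, 0 < h0 & forall h, 0 < h -> h <= h0 -> `|1 - RC h * z| < 1.
Proof.
case: z => x y /= x0; set q := x ^+ 2 + y ^+ 2.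
have q0 : 0 <= q by rewrite addr_ge0 ?sqr_ge0.
have q1 : 0 < q + 1 by rewrite ltr_wpDl.
exists (x / (q + 1)); first by rewrite divr_gt0.
move=> h h0 hle; rewrite normc_def /= -[X in _ < X](rmorph1 RC) ltcR -[X in _ < X]sqrtr1.
rewrite ltr_sqrt //.
have hq : h * q < x *+ 2.
  rewrite ler_pdivlMr // in hle.
  have h3 : h * q <= x by rewrite (le_trans _ hle) // ler_wpM2l ?lerDl // ltW.
  by rewrite (le_lt_trans h3) // mulr2n ltrDl.
have := mulr_gt0 h0 (_ : 0 < x *+ 2 - h * q); rewrite subr_gt0 => /(_ hq) hh.
rewrite -subr_gt0; apply: (lt_le_trans hh); rewrite /q.
rewrite le_eqVlt; apply/orP; left; apply/eqP; ring.
Qed.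

Lemma euler_step_contraction_seq (r : seq R[i]) :
  (forall z, z \in r -> 0 < complex.Re z) ->
  exists h rho : R, [/\ 0 < h, 0 <= rho, rho < 1 &
    forall z, z \in r -> `|1 - RC h * z| < RC rho].
Proof.
move=> rpos.
have [h0 h00 hh] : exists2 h0 : R, 0 < h0 & forall h, 0 < h -> h <= h0 ->
    forall z, z \in r -> `|1 - RC h * z| < 1.
  elim: r rpos => [_|z r IH rpos]; first by exists 1.
  have [|h1 h10 hh1] := IH; first by move=> w wr; apply: rpos; rewrite inE wr orbT.
  have [|h2 h20 hh2] := @euler_step_contraction z; first by apply: rpos; rewrite mem_head.
  exists (Num.min h1 h2); first by rewrite lt_min h10.
  move=> h h0; rewrite le_min => /andP[hle1 hle2] w; rewrite inE => /orP[/eqP ->|wr].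
    exact: hh2.
  exact: hh1.
exists h0; have {}hh := hh h0 h00 (lexx _).
elim: r hh {rpos} => [_|z r IH hh]; first by exists 0; split.
have [|rho1 [_ rho10 rho11 hrho1]] := IH; first by move=> w wr; apply: hh; rewrite inE wr orbT.
have := hh z (mem_head _ _).
rewrite normc_def -[X in _ < X](rmorph1 RC) ltcR; set k := Num.sqrt _ => k1.
have k0 : 0 <= k by exact: sqrtr_ge0.
exists (Num.max rho1 ((k + 1) / 2)); split => //.
- by rewrite le_max rho10.
- by rewrite gt_max rho11 /= ltr_pdivrMr // mul1r; lra.
move=> w; rewrite inE => /orP[/eqP ->|wr].
  rewrite normc_def ltcR -[X in X < _]/k lt_max; apply/orP; right.
  by rewrite ltr_pdivlMr //; lra.
by apply: lt_le_trans (hrho1 _ wr) _; rewrite lecR le_max lexx.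
Qed.

(** One root at a time: if [E - z] maps [W] to a matrix on which the powers of
    [1 - h E] decay geometrically, then the entries of those powers on [W] satisfy
    [u_(k+1) = (1 - h z) u_k + O(rho ^ k)] with [`|1 - h z| < rho], so they are
    themselves of order [rho ^ k]. *)
Lemma annihilated_geometric n (E W : 'M[R[i]]_n.+1) (h rho : R) (r : seq R[i]) :
  0 < h -> 0 <= rho ->
  (forall z, z \in r -> `|1 - RC h * z| < RC rho) ->
  horner_mx E (\prod_(z <- r) ('X - z%:P)) * W = 0 ->
  exists2 C : R[i], 0 <= C & forall k i j,
    `|((1 - RC h *: E) ^+ k * W) i j| <= C * RC rho ^+ k.
Proof.
move=> h0 rho0; elim: r W => [W _|z r IH W hr].
  rewrite big_nil rmorph1 mul1r => ->; exists 0 => // k i j.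
  by rewrite mulr0 mxE normr0 mul0r.
rewrite big_cons mulrC rmorphM rmorphB /= horner_mx_X horner_mx_C -mulrA => EW.
have [w wr|C C0 HC] := IH _ _ EW; first by apply: hr; rewrite inE wr orbT.
have zr := hr z (mem_head _ _).
set l := `|1 - RC h * z| in zr.
have rl : 0 < RC rho - l by rewrite subr_gt0.
have hC : 0 < RC h by rewrite -(rmorph0 RC) ltcR.
have rC : 0 <= RC rho by rewrite -(rmorph0 RC) lecR.
(* The first term bounds the entries for [k = 0]; the second one makes the bound
   stable under the recurrence. *)
pose C' := \sum_i \sum_j `|W i j| + RC h * C / (RC rho - l).
have S0 : 0 <= \sum_i \sum_j `|W i j|.
  by apply: sumr_ge0 => i _; apply: sumr_ge0 => j _.
have T0 : 0 <= RC h * C / (RC rho - l) by rewrite divr_ge0 ?mulr_ge0 // ltW.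
have C'0 : 0 <= C' by rewrite addr_ge0.
exists C' => // k i j.
elim: k i j => [|k IHk] i j.
  rewrite expr0 mul1r mulr1 /C'.
  apply: (@le_trans _ _ (\sum_i \sum_j `|W i j|)); last by rewrite lerDl.
  rewrite (bigD1 i) //= (bigD1 j) //= -addrA lerDl.
  by rewrite addr_ge0 //; [apply: sumr_ge0 => ? _ | apply: sumr_ge0 => ? _; apply: sumr_ge0 => ? _].
have step : (1 - RC h *: E) ^+ k.+1 * W =
   (1 - RC h * z) *: ((1 - RC h *: E) ^+ k * W)
   - RC h *: ((1 - RC h *: E) ^+ k * ((E - z%:M) * W)).
  rewrite exprSr -!mulrA !scalerAr -mulrBr; congr (_ * _).
  have zW : z%:M * W = z *: W by rewrite -mulmxE mul_scalar_mx.
  by rewrite !mulrBl mul1r scalerBl scale1r -scalerAl -!scalerAr zW scalerA opprB addrA subrK.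
rewrite step !mxE.
apply: le_trans (ler_normB _ _) _; rewrite !normrM -/l.
have h1 : l * `|((1 - RC h *: E) ^+ k * W) i j| <= l * (C' * RC rho ^+ k).
  by apply: ler_wpM2l; [exact: normr_ge0 | have := IHk i j; rewrite mxE].
have h2 : `|RC h| * `|((1 - RC h *: E) ^+ k * ((E - z%:M) * W)) i j| <=
    (RC rho - l) * (C' * RC rho ^+ k).
  rewrite (gtr0_norm hC).
  apply: (@le_trans _ _ (RC h * (C * RC rho ^+ k))).
    by apply: ler_wpM2l; [exact: ltW | exact: HC].
  have hC' : RC h * C <= (RC rho - l) * C'.
    by rewrite [leRHS]mulrC -ler_pdivrMr // /C' lerDr.
  by rewrite !mulrA ler_wpM2r ?exprn_ge0.
rewrite !mxE in h1 h2.
apply: le_trans (lerD h1 h2) _.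
by rewrite -mulrDl addrC subrK exprS mulrCA.
Qed.

(** By the Cayley-Hamilton theorem the product of the [E - z] over the roots of
    the characteristic polynomial annihilates everything. *)
Lemma powers_geometric n (E : 'M[R]_n.+1) :
  (forall z, eigenvalue (complex_mx E) z -> 0 < complex.Re z) ->
  exists h rho C : R, [/\ 0 < h, rho < 1, 0 <= C &
    forall k, `|(1 - h *: E) ^+ k| <= C * rho ^+ k].
Proof.
move=> Epos; set EC := complex_mx E.
have [r Er] := closed_field_poly_normal (char_poly EC).
rewrite (monicP (char_poly_monic EC)) scale1r in Er.
have rpos z : z \in r -> 0 < complex.Re z.
  move=> zr; apply: Epos; rewrite eigenvalue_root_char Er.
  by rewrite root_prod_XsubC.
have [h [rho [h0 rho0 rho1 hr]]] := euler_step_contraction_seq rpos.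
have [|C C0 HC] := @annihilated_geometric _ EC 1 _ _ _ h0 rho0 hr.
  by rewrite -Er Cayley_Hamilton mul0r.
exists h, rho, (complex.Re C); split=> //.
  by move: C0; rewrite lecE /= => /andP[].
have CE : C = RC (complex.Re C).
  by move: C0; rewrite lecE /= => /andP[/eqP]; case: (C) => a b /= -> _.
have Cr : 0 <= complex.Re C by move: C0; rewrite lecE /= => /andP[].
move=> k; apply: mx_norm_le => [|i j]; first by rewrite mulr_ge0 ?exprn_ge0.
have := HC k i j.
have -> : 1 - RC h *: EC = map_mx RC (1 - h *: E).
  by rewrite map_mxB map_mx1 map_mxZ.
rewrite mulr1 -rmorphXn mxE {1}CE -rmorphXn -rmorphM /=.
by rewrite normc_def /= expr0n addr0 sqrtr_sqr lecR.
Qed.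

Lemma norm_expmx_geometric n (A : 'M[R]_n.+1) (C rho x : R) :
  0 <= C -> 0 <= x -> (forall k, `|A ^+ k| <= C * rho ^+ k) ->
  `|expmx (x *: A)| <= C * expR (rho * x).
Proof.
move=> C0 x0 AC.
have c1 : `|series (expmx_coeff (x *: A)) m| @[m --> \oo] --> `|expmx (x *: A)|.
  by apply: cvg_norm; exact: cvg_expmx.
have c2 : C * series (exp_coeff (rho * x)) m @[m --> \oo] --> C * expR (rho * x).
  by apply: cvgM; [exact: cvg_cst | exact: is_cvg_series_exp_coeff].
apply: (ler_cvg_to c1 c2); apply: nearW => m.
rewrite /series /= mulr_sumr; apply: le_trans (ler_norm_sum _ _ _) _.
apply: ler_sum_nat => k _.
rewrite /expmx_coeff exprZn scalerA mx_normZ ger0_norm ?mulr_ge0 ?exprn_ge0 //.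
apply: le_trans (ler_wpM2l _ (AC k)) _; first by rewrite mulr_ge0 ?exprn_ge0.
rewrite /exp_coeff /= exprMn le_eqVlt; apply/orP; left; apply/eqP; ring.
Qed.

Lemma expmx_scalar n (a : R) : expmx (a *: (1 : 'M[R]_n.+1)) = expR a *: 1.
Proof.
have c : series (expmx_coeff (a *: (1 : 'M[R]_n.+1))) m @[m --> \oo] --> expR a *: (1 : 'M[R]_n.+1).
  have -> : series (expmx_coeff (a *: (1 : 'M[R]_n.+1))) =
      (fun m => series (exp_coeff a) m *: (1 : 'M[R]_n.+1)).
    apply/funext => m; rewrite /series /= scaler_suml; apply: eq_bigr => k _.
    by rewrite /expmx_coeff /exp_coeff exprZn expr1n scalerA mulrC.
  by apply: cvgZr_tmp; exact: is_cvg_series_exp_coeff.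
exact: (cvg_unique _ (@cvg_expmx _ _ _) c).
Qed.

(** With [M = 1 - h E], whose powers decay like [rho ^ k] for some [rho < 1],
    [expmx (- s *: E)] is [expR (- (s / h)) *: expmx ((s / h) *: M)], of norm at most
    a multiple of [expR (- (1 - rho) * s / h)]. *)
Lemma expmx_decay n (E : 'M[R]_n.+1) :
  (forall z, eigenvalue (complex_mx E) z -> 0 < complex.Re z) ->
  expmx (- s *: E) @[s --> +oo] --> (0 : 'M[R]_n.+1).
Proof.
move=> Epos; have [h [rho [C [h0 rho1 C0 HC]]]] := powers_geometric Epos.
pose M := 1 - h *: E.
have bd s : 0 <= s -> `|expmx (- s *: E)| <= C * expR (- ((1 - rho) / h) * s).
  move=> s0.
  have -> : - s *: E = (s / h) *: M + (- (s / h)) *: 1.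
    rewrite /M scalerBr scalerA divfK ?gt_eqF // scaleNr [in RHS]addrC addrA.
    by rewrite scaleNr addNr add0r.
  rewrite expmxD; last by rewrite -!scalerAr -!scalerAl mul1r mulr1 !scalerA mulrC.
  rewrite expmx_scalar -scalerAr mulr1 mx_normZ gtr0_norm ?expR_gt0 // mulrC.
  have x0 : 0 <= s / h by rewrite divr_ge0 // ltW.
  apply: le_trans (ler_wpM2r (expR_ge0 _) (norm_expmx_geometric C0 x0 HC)) _.
  rewrite -mulrA -expRD le_eqVlt; apply/orP; left; apply/eqP; congr (_ * expR _).
  ring.
have a0 : 0 < (1 - rho) / h by rewrite divr_gt0 // subr_gt0.
set a := (1 - rho) / h in bd a0.
apply: (@cvg0_norm_le _ _ _ _ _ _ _ (fun s => C / a * s^-1)).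
  apply: filterS (nbhs_pinfty_gt (num_real (0 : R))) => s s0.
  apply: le_trans (bd _ (ltW s0)) _; rewrite -mulrA ler_wpM2l //.
  rewrite mulNr expRN -invfM lef_pV2 ?posrE ?expR_gt0 ?(mulr_gt0 a0 s0) //.
  by apply: le_trans (expR_ge1Dx _); rewrite lerDr.
have sV : s^-1 @[s --> +oo] --> (0 : R).
  by apply/gtr0_cvgV0; [exact: nbhs_pinfty_gt | exact: cvg_id].
have := cvgM (cvg_cst (C / a)) sV.
by rewrite mulr0 => H; exact: H.
Qed.

End Decay.

(** * Random matrices *)

Section RandomMatrix.
Context {R : realType} {disp : measure_display} {T : measurableType disp}.
Variable P : probability T R.

Definition random_mx m k (Y : T -> 'M[R]_(m, k)) : Prop :=
  measurable_fun [set: T] (Y : T -> @borel_mx R m k).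

Lemma open_measurable_mx m k (U : set 'M[R]_(m, k)) :
  open U -> measurable (U : set (@borel_mx R m k)).
Proof. by move=> oU; exact: sub_sigma_algebra. Qed.

Lemma random_mx_measurable m k (Y : T -> 'M[R]_(m, k)) (A : set (@borel_mx R m k)) :
  random_mx Y -> measurable A -> measurable (Y @^-1` A).
Proof. by move=> mY mA; rewrite -[X in measurable X]setTI; exact: mY. Qed.

Lemma random_mx_open m k (Y : T -> 'M[R]_(m, k)) U :
  random_mx Y -> open U -> measurable (Y @^-1` U).
Proof. by move=> mY oU; apply: random_mx_measurable => //; exact: open_measurable_mx. Qed.

Lemma measurable_mx_box m k (Y : T -> 'M[R]_(m, k)) (q : 'M[R]_(m, k)) r :
  (forall i j, measurable_fun [set: T] (fun w => Y w i j)) ->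
  measurable [set w | forall i j, `|Y w i j - q i j| < r].
Proof.
move=> mY.
have -> : [set w | forall i j, `|Y w i j - q i j| < r] =
    ~` (\bigcup_(ij : 'I_m * 'I_k) ~` [set w | `|Y w ij.1 ij.2 - q ij.1 ij.2| < r]).
  rewrite setC_bigcup; apply/seteqP; split => w /= h.
    by move=> [i j] _; rewrite setCK; exact: h.
  by move=> i j; have := h (i, j) Logic.I; rewrite setCK.
apply: measurableC; apply: countable_bigcupT_measurable; first exact: countableP.
move=> [i j] /=; apply: measurableC.
have -> : [set w | `|Y w i j - q i j| < r] =
    (fun w => Y w i j) @^-1` `](q i j - r), (q i j + r)[.
  by apply/seteqP; split => w /=; rewrite in_itv /= ltr_distl.
by rewrite -[X in measurable X]setTI; exact: mY.
Qed.

(** Every open set of matrices is a countable union of boxes with rational centre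
    and radius, so the Borel sets of the matrix space are generated by the
    coordinates. *)
Lemma random_mxP m k (Y : T -> 'M[R]_(m, k)) :
  random_mx Y <-> forall i j, measurable_fun [set: T] (fun w => Y w i j).
Proof.
split=> [mY i j|mY].
  apply: (measurability _ (RGenOpens.measurableE R)) => _ [_ [x [y ->]] <-].
  rewrite setTI; apply: (random_mx_open (U := (fun M : 'M[R]_(m, k) => M i j) @^-1` `]x, y[)) => //.
  apply: open_comp; last exact: itv_open.
  by move=> M _; exact: coord_continuous.
apply: (@measurability _ _ T (@borel_mx R m k) setT Y (@open 'M[R]_(m, k)) erefl).
move=> _ [U oU <-].
rewrite setTI.
pose box (qr : 'M[rat]_(m, k) * rat) : set 'M[R]_(m, k) :=
  [set M | forall i j, `|M i j - (map_mx ratr qr.1 : 'M[R]_(m, k)) i j| < ratr qr.2].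
pose F qr := Y @^-1` (if `[< box qr `<=` U >] then box qr else set0).
have -> : Y @^-1` U = \bigcup_qr F qr.
  apply/seteqP; split => w; last first.
    move=> [qr _]; rewrite /F /=; case: asboolP => // h; exact: h.
  move=> /= Uw; have := oU; rewrite openE => /(_ _ Uw).
  rewrite /interior => /nbhs_ballP[e e0 eU].
  have e20 : 0 < e / 2 by rewrite divr_gt0.
  have [r] := rat_in_itvoo e20; rewrite in_itv /= => /andP[r0 re].
  have ex i j : exists q : rat, `|Y w i j - ratr q| < ratr r.
    have [|q] := @rat_in_itvoo R (Y w i j - ratr r) (Y w i j + ratr r).
      by rewrite ltrBlDr -addrA ltrDl addr_gt0.
    by rewrite in_itv /= => qh; exists q; rewrite distrC ltr_distl.
  pose q : 'M[rat]_(m, k) := \matrix_(i, j) projT1 (cid (ex i j)).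
  have qw : box (q, r) (Y w).
    by move=> i j; rewrite /= !mxE; case: cid.
  exists (q, r) => //; rewrite /F /=.
  case: asboolP => // -[] M hM; apply: eU.
  rewrite mx_norm_ball /=; apply: mx_norm_lt => // i j; rewrite !mxE.
  rewrite (_ : _ - _ = (Y w i j - (map_mx ratr q : 'M[R]_(m, k)) i j)
    - (M i j - (map_mx ratr q : 'M[R]_(m, k)) i j)); last by ring.
  apply: le_lt_trans (ler_normB _ _) _.
  rewrite (splitr e); apply: lt_trans (ltrD (qw i j) (hM i j)) _.
  by rewrite /= ltrD.
apply: countable_bigcupT_measurable; first exact: countableP.
move=> qr; rewrite /F; case: asboolP => _; last by rewrite preimage_set0.
exact: measurable_mx_box.
Qed.

Lemma random_mxM m k p (A : 'M[R]_(p, m)) (Y : T -> 'M[R]_(m, k)) :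
  random_mx Y -> random_mx (fun w => A *m Y w).
Proof.
move=> /random_mxP mY; apply/random_mxP => i j.
under eq_fun do rewrite mxE.
apply: measurable_sum => l; exact: measurable_funM.
Qed.

Lemma random_mxB m k (Y Z : T -> 'M[R]_(m, k)) :
  random_mx Y -> random_mx Z -> random_mx (fun w => Y w - Z w).
Proof.
move=> /random_mxP mY /random_mxP mZ; apply/random_mxP => i j.
under eq_fun do rewrite !mxE.
exact: measurable_funB.
Qed.

Lemma open_norm_gt m k c : open [set M : 'M[R]_(m, k) | c < `|M|].
Proof.
have : open ((fun M : 'M[R]_(m, k) => `|M|) @^-1` [set x | c < x]).
  apply: open_comp; last exact: open_gt.
  by move=> M _; exact: norm_continuous.
by [].
Qed.

Lemma open_norm_lt m k c : open [set M : 'M[R]_(m, k) | `|M| < c].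
Proof.
have : open ((fun M : 'M[R]_(m, k) => `|M|) @^-1` [set x | x < c]).
  apply: open_comp; last exact: open_lt.
  by move=> M _; exact: norm_continuous.
by [].
Qed.

Lemma measurable_norm_gt m k (Y : T -> 'M[R]_(m, k)) c :
  random_mx Y -> measurable [set w | c < `|Y w|].
Proof. by move=> mY; exact: (random_mx_open mY (@open_norm_gt m k c)). Qed.

Lemma measurable_norm_ge m k (Y : T -> 'M[R]_(m, k)) c :
  random_mx Y -> measurable [set w | c <= `|Y w|].
Proof.
move=> mY; have -> : [set w | c <= `|Y w|] = ~` (Y @^-1` [set M | `|M| < c]).
  by apply/seteqP; split => w /=; rewrite leNgt => /negP.
by apply: measurableC; exact: (random_mx_open mY (@open_norm_lt m k c)).
Qed.

Lemma prob_le (A B : set T) : measurable A -> measurable B -> A `<=` B -> (P A <= P B)%E.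
Proof. by move=> mA mB AB; apply: le_measure; rewrite ?inE. Qed.

Lemma prob_leU (A B C : set T) (a b : \bar R) :
  measurable A -> measurable B -> measurable C -> A `<=` B `|` C ->
  (P B <= a)%E -> (P C <= b)%E -> (P A <= a + b)%E.
Proof.
move=> mA mB mC AB Ba Cb; apply: le_trans (prob_le mA _ AB) _.
  exact: measurableU.
by apply: le_trans (measureU2 _ mB mC) _; exact: leeD.
Qed.

Lemma prob_decreasing_small (A : (set T)^nat) e : 0 < e ->
  (forall i, measurable (A i)) -> (forall i j, (i <= j)%N -> A j `<=` A i) ->
  exists n, (P (A n) <= P (\bigcap_i A i) + e%:E)%E.
Proof.
move=> e0 mA Adec.
have mI : measurable (\bigcap_i A i) by exact: bigcap_measurableType.
have h : (P \o A) x @[x --> \oo] --> P (\bigcap_i A i).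
  apply: nonincreasing_cvg_mu => //.
  - by rewrite (le_lt_trans (probability_le1 P (mA 0%N))) // ltry.
  - by move=> i j ij; apply/subsetPset; exact: Adec.
pose a := fine (P (\bigcap_i A i)).
have aE : P (\bigcap_i A i) = a%:E by rewrite fineK // fin_num_measure.
have : \forall n \near \oo, ((P \o A) n < (a + e)%:E)%E.
  move: h; rewrite aE => h.
  have /h : nbhs (a%:E : \bar R) [set y | (y < (a + e)%:E)%E].
    apply: open_nbhs_nbhs; split; last by rewrite /= lte_fin ltrDl.
    exact: open_ereal_lt_ereal.
  exact.
move=> /filter_ex[n /= hn]; exists n; rewrite aE -EFinD; exact: ltW.
Qed.

Lemma random_mx_tight m k (Y : T -> 'M[R]_(m, k)) e : 0 < e -> random_mx Y ->
  exists2 c, 0 <= c & (P [set w | (c <= `|Y w|)%R] <= e%:E)%E.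
Proof.
move=> e0 mY; pose A n := [set w | n%:R <= `|Y w|].
have [||n hn] := @prob_decreasing_small A _ e0.
- by move=> i; exact: measurable_norm_ge.
- by move=> i j ij w /=; apply: le_trans; rewrite ler_nat.
exists n%:R => //; apply: le_trans hn _.
rewrite (_ : \bigcap_i A i = set0) ?measure0 ?add0e //.
apply/seteqP; split => // w Aw.
have h : (Num.truncn `|Y w|).+1%:R <= `|Y w| := Aw _ Logic.I.
by have := truncnS_gt (`|Y w|); rewrite ltNge h.
Qed.

End RandomMatrix.

(** * Limits of equalities in law *)

Section LimitLaw.
Context {R : realType} {disp : measure_display} {T : measurableType disp}.
Variable P : probability T R.
Variables (m k : nat).
Implicit Types (U V : T -> 'M[R]_(m, k)) (F : set 'M[R]_(m, k)).

Definition thickening F (e : R) : set 'M[R]_(m, k) :=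
  \bigcup_(y in F) [set x | `|x - y| < e].

Lemma open_thickening F e : open (thickening F e).
Proof.
apply: bigcup_open => y _.
have : open ((fun x : 'M[R]_(m, k) => x - y) @^-1` [set x | `|x| < e]).
  apply: open_comp; last exact: open_norm_lt.
  move=> x _; exact: (@cvgB _ _ _ (nbhs x) _ id (fun=> y) x y cvg_id (cvg_cst y)).
by [].
Qed.

Lemma closed_bigcap_thickening F : closed F ->
  \bigcap_n thickening F n.+1%:R^-1 = F.
Proof.
move=> cF; apply/seteqP; split => [x hx|x Fx n _]; last first.
  by exists x => //=; rewrite subrr normr0 invr_gt0.
rewrite closure_id in cF; rewrite cF => B /nbhs_ballP[e e0 eB].
have [n ne] : exists n, n.+1%:R^-1 < e.
  exists (Num.truncn e^-1); rewrite -[ltRHS]invrK ltf_pV2 ?posrE ?invr_gt0 //.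
  exact: truncnS_gt.
have [y Fy /= xy] := hx n Logic.I; exists y; split => //; apply: eB.
by rewrite mx_norm_ball /=; exact: lt_trans xy ne.
Qed.

Definition eq_law U V : Prop :=
  forall A : set (@borel_mx R m k), measurable A -> P (U @^-1` A) = P (V @^-1` A).

(** If [U] is in [F], then [U'] is close to [F] up to a small probability, hence
    so is [V'] because it has the same law, hence so is [V]. The neighbourhoods of a
    closed set decrease to it. *)
Lemma limit_law_le U V F : random_mx U -> random_mx V -> closed F ->
  (forall e : R, 0 < e -> exists U' V', [/\ random_mx U', random_mx V', eq_law U' V',
    (P [set w | (e <= `|U w - U' w|)%R] <= e%:E)%E &
    (P [set w | (e <= `|V w - V' w|)%R] <= e%:E)%E]) ->
  (P (U @^-1` F) <= P (V @^-1` F))%E.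
Proof.
move=> mU mV cF H.
have mUF : measurable (U @^-1` F).
  rewrite -[F]setCK preimage_setC; apply: measurableC.
  by exact: (random_mx_open mU (closed_openC cF)).
apply/lee_addgt0Pr => e e0.
pose A n := V @^-1` (thickening F n.+1%:R^-1).
have [|||n hn] := @prob_decreasing_small _ _ _ P A (e / 2).
- by rewrite divr_gt0.
- by move=> i; rewrite /A; apply: random_mx_open => //; exact: open_thickening.
- move=> i j ij w [y Fy /= h]; exists y => //=; apply: lt_le_trans h _.
  by rewrite lef_pV2 ?posrE // ler_nat.
rewrite -preimage_bigcap closed_bigcap_thickening // in hn.
pose d := Num.min (e / 4) (n.+1%:R^-1 / 2 : R).
have d0 : 0 < d by rewrite lt_min !divr_gt0 ?invr_gt0.
have [U' [V' [mU' mV' UV' dU dV]]] := H _ d0.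
have mth r (W : T -> 'M[R]_(m, k)) : random_mx W -> measurable (W @^-1` thickening F r).
  by move=> mW; apply: random_mx_open => //; exact: open_thickening.
have s1 : (P (U @^-1` F) <= P (V' @^-1` thickening F d) + d%:E)%E.
  rewrite -UV'; last by apply: open_measurable_mx; exact: open_thickening.
  apply: (prob_leU _ _ _ _ (lexx _) dU) => //.
  - exact: mth.
  - by apply: measurable_norm_ge; exact: random_mxB.
  - move=> w /= Fw; have [h|h] := ltP `|U w - U' w| d; [left|by right].
    by exists (U w) => //=; rewrite distrC.
have s2 : (P (V' @^-1` thickening F d) <= P (A n) + d%:E)%E.
  apply: (prob_leU _ _ _ _ (lexx _) dV) => //.
  - exact: mth.
  - exact: mth.
  - by apply: measurable_norm_ge; exact: random_mxB.
  - move=> w [y Fy /= h]; have [h'|h'] := ltP `|V w - V' w| d; [left|by right].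
    exists y => //=; rewrite -(subrK (V' w) (V w)) -addrA.
    apply: le_lt_trans (ler_normD _ _) _; apply: lt_le_trans (ltrD h' h) _.
    have dn : d <= n.+1%:R^-1 / 2 by rewrite ge_min lexx orbT.
    by rewrite [leRHS]splitr lerD.
apply: le_trans s1 _; apply: le_trans (leeD s2 (lexx _)) _.
apply: le_trans (leeD (leeD hn (lexx _)) (lexx _)) _.
rewrite -!addeA leeD2l // -!EFinD lee_fin.
have : d <= e / 4 by rewrite ge_min lexx.
by lra.
Qed.

(** Closed sets, like open ones, determine a law, since open sets are stable under
    intersection and generate the Borel sets. *)
Lemma eq_law_closed U V : random_mx U -> random_mx V ->
  (forall F, closed F -> P (U @^-1` F) = P (V @^-1` F)) -> eq_law U V.
Proof.
move=> mU mV UV A mA.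
have opreal (W : T -> 'M[R]_(m, k)) (mW : random_mx W) B : open B ->
    P (W @^-1` B) = (1 - P (W @^-1` (~` B)))%E.
  move=> oB; rewrite preimage_setC -probability_setC ?setCK //.
  by apply: measurableC; exact: (random_mx_open mW oB).
pose mu := measure_function_pushforward__canonical__measure_function_Measure P mU.
pose nu := measure_function_pushforward__canonical__measure_function_Measure P mV.
have gen : measurable = <<s @open 'M[R]_(m, k) >> :> set (set (@borel_mx R m k)) by [].
have setIo : setI_closed (@open 'M[R]_(m, k)) by move=> B C oB oC; exact: openI.
have oT (i : nat) : open ((fun=> setT) i : set 'M[R]_(m, k)) by exact: openT.
have cT : \bigcup_(i : nat) ((fun=> setT) i) = [set: @borel_mx R m k].
  by rewrite bigcup_const //; exists 0%N.
apply: (@measure_unique _ R _ _ (fun=> setT) gen setIo oT cT mu nu _ _ _ mA).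
- move=> B oB; change (P (U @^-1` B) = P (V @^-1` B)).
  by rewrite (opreal _ mU _ oB) (opreal _ mV _ oB) UV //; exact: open_closedC.
- move=> i; change (P (U @^-1` setT) < +oo)%E.
  by rewrite preimage_setT probability_setT ltry.
Qed.

End LimitLaw.

(** * Full laws and convergence of types *)

Section LinearlyFull.
Context {R : realType} {disp : measure_display} {T : measurableType disp}.
Variable P : probability T R.

(** This is fullness with respect to linear hyperplanes. It is what the argument
    needs, and unlike affine fullness it holds for the homogenized field of
    [homogenize]. *)
Definition linearly_full m (Z : T -> 'cV[R]_m) : Prop :=
  forall u : 'rV[R]_m, u != 0 -> P [set w | u *m Z w != 0] != 0%E.

Lemma norm_mx11 (A : 'M[R]_1) : `|A| = `|A 0 0|.
Proof.
apply/eqP; rewrite eq_le mx_entry_le_norm andbT.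
by apply: mx_norm_le => // i j; rewrite !ord1.
Qed.

Lemma open_affine_neq0 m (v : 'rV[R]_m) (c : 'M[R]_1) :
  open [set y : 'cV[R]_m | v *m y + c != 0].
Proof.
have -> : [set y : 'cV[R]_m | v *m y + c != 0] =
    (fun y => v *m y + c) @^-1` [set M : 'M[R]_1 | 0 < `|M|].
  by apply/seteqP; split => M /=; rewrite normr_gt0.
apply: open_comp; last exact: open_norm_gt.
move=> M _; apply: (@cvgD _ _ _ (nbhs M)); last exact: cvg_cst.
exact: (cvg_mulmx _ (cvg_cst v) (@cvg_id _ (nbhs M))).
Qed.

Lemma linearly_full_at m (Z : T -> 'cV[R]_m) (u : 'rV[R]_m) :
  random_mx Z -> linearly_full Z -> u != 0 ->
  exists2 d : R, 0 < d & (d%:E < P [set w | (d < `|u *m Z w|)%R])%E.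
Proof.
move=> mZ fZ u0; have muZ := random_mxM u mZ.
pose A n := [set w | `|u *m Z w| <= n.+1%:R^-1].
have mA i : measurable (A i).
  rewrite (_ : A i = ~` [set w | i.+1%:R^-1 < `|u *m Z w|]).
    by apply: measurableC; exact: measurable_norm_gt.
  by apply/seteqP; split => w /=; rewrite /A /= leNgt => /negP.
have m0 : measurable [set w | u *m Z w = 0].
  rewrite (_ : [set w | _] = ~` [set w | 0 < `|u *m Z w|]).
    by apply: measurableC; exact: measurable_norm_gt.
  apply/seteqP; split => w /=; first by move=> ->; rewrite normr0 ltxx.
  by move/negP; rewrite normr_gt0 negbK => /eqP.
have capA : \bigcap_i A i = [set w | u *m Z w = 0].
  apply/seteqP; split => w /=; last by move=> uw i _; rewrite /A /= uw normr0.
  move=> h; apply/eqP; rewrite -normr_eq0 eq_le normr_ge0 andbT leNgt.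
  apply/negP => w0; have := h (Num.truncn (`|u *m Z w|^-1)) Logic.I.
  rewrite /A /= leNgt -[X in _ < X]invrK ltf_pV2 ?posrE ?invr_gt0 //.
  by rewrite truncnS_gt.
have p1 : (P [set w | (u *m Z w = 0)%R] < 1)%E.
  rewrite lt_neqAle probability_le1 // andbT; apply/eqP => p1.
  have /eqP := fZ u u0; apply.
  rewrite (_ : [set w | _] = ~` [set w | u *m Z w = 0]); last first.
    by apply/seteqP; split => w /= /eqP.
  by rewrite probability_setC // p1 subee.
pose p := fine (P [set w | (u *m Z w = 0)%R]).
have pE : P [set w | (u *m Z w = 0)%R] = p%:E by rewrite fineK // fin_num_measure.
rewrite pE lte_fin in p1.
have [||n hn] := @prob_decreasing_small _ _ _ P A ((1 - p) / 2) _ mA.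
- by rewrite divr_gt0 // subr_gt0.
- move=> i j ij w /=; rewrite /A /= => /le_trans; apply.
  by rewrite lef_pV2 ?posrE // ler_nat.
rewrite capA pE -EFinD in hn.
pose d := Num.min n.+1%:R^-1 ((1 - p) / 4).
have d0 : 0 < d by rewrite lt_min invr_gt0 ltr0n /= divr_gt0 // subr_gt0.
exists d => //.
have dn : d <= n.+1%:R^-1 by rewrite ge_min lexx.
have dp : d <= (1 - p) / 4 by rewrite ge_min lexx orbT.
apply: (@lt_le_trans _ _ (P (~` A n))); last first.
  apply: prob_le => //; first exact: measurableC.
    exact: measurable_norm_gt.
  move=> w /= /negP; rewrite -ltNge; exact: le_lt_trans.
rewrite probability_setC //.
pose q := fine (P (A n)).
have qE : P (A n) = q%:E by rewrite fineK // fin_num_measure.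
rewrite qE lee_fin in hn *; rewrite -EFinB lte_fin; lra.
Qed.

(** The bound of [linearly_full_at] persists with a smaller constant on a
    neighbourhood of each row, because [Z] is tight; the unit sphere is compact. *)
Lemma linearly_full_uniform m (Z : T -> 'cV[R]_m) :
  random_mx Z -> linearly_full Z ->
  exists2 d : R, 0 < d & forall u : 'rV[R]_m, `|u| = 1 ->
    (d%:E < P [set w | (d < `|u *m Z w|)%R])%E.
Proof.
move=> mZ fZ; pose S := [set u : 'rV[R]_m | `|u| = 1].
have cS : compact S.
  apply: bounded_closed_compact.
    exists 1; split => [|x x1 u /= ->]; [exact: num_real | exact: ltW].
  have : closed ((fun u : 'rV[R]_m => `|u|) @^-1` [set 1]).
    apply: closed_comp; last exact: closed_eq.
    by move=> u _; exact: norm_continuous.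
  by [].
have := (compact_near_coveringP S).1 cS R (0 : R)^'+
  (fun d u => (d%:E < P [set w | (d < `|u *m Z w|)%R])%E) _.
move=> /(_ _) near.
have : \forall d \near (0 : R)^'+, S `<=` (fun u => (d%:E < P [set w | (d < `|u *m Z w|)%R])%E).
  apply: near => u0 Su0.
  have u0n0 : u0 != 0 by rewrite -normr_gt0 Su0.
  have [d0 d00 Pd0] := linearly_full_at mZ fZ u0n0.
  have d40 : 0 < d0 / 4 by rewrite divr_gt0.
  have d20 : 0 < d0 / 2 by rewrite divr_gt0.
  have [c c0 Pc] := random_mx_tight P d20 mZ.
  (* Within [r] of [u0], and where [Z] is below [c], products with [Z] move by at
     most [d0 / 2]. *)
  pose r := d0 / 2 / (m%:R * c + 1).
  have mc1 : 0 < m%:R * c + 1 by rewrite ltr_wpDl // mulr_ge0.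
  have r0 : 0 < r by rewrite divr_gt0.
  exists ([set u | `|u0 - u| < r], [set d | 0 < d /\ d < d0 / 4]).
    split => /=.
      by apply/nbhs_ballP; exists r => // u; rewrite mx_norm_ball.
    apply: filterI; first exact: nbhs_right_gt.
    exact: nbhs_right_lt.
  move=> [u d] /= [ur [dd0 dd4]].
  have sub : [set w | d0 < `|u0 *m Z w|] `<=` [set w | d < `|u *m Z w|] `|` [set w | c <= `|Z w|].
    move=> w /= hw; have [h|h] := ltP (`|Z w|) c; [left|by right].
    rewrite ltNge; apply/negP => hd; move: hw; apply/negP; rewrite -leNgt.
    rewrite -[u0](subrK u) mulmxDl; apply: le_trans (ler_normD _ _) _.
    have h1 : `|(u0 - u) *m Z w| <= d0 / 2.
      apply: le_trans (norm_mulmx _ _) _.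
      have : m%:R * `|u0 - u| * `|Z w| <= m%:R * r * c.
        by rewrite ler_pM ?mulr_ge0 // ?ler_wpM2l // ltW.
      move=> /le_trans; apply; have -> : m%:R * r * c = d0 / 2 * (m%:R * c / (m%:R * c + 1)).
        by rewrite /r; field; rewrite gt_eqF.
      by rewrite ler_piMr ?(ltW d20) // ler_pdivrMr // mul1r lerDl.
    lra.
  have mL : measurable [set w | d0 < `|u0 *m Z w|].
    by apply: measurable_norm_gt; exact: random_mxM.
  have mM : measurable [set w | d < `|u *m Z w|].
    by apply: measurable_norm_gt; exact: random_mxM.
  have mN : measurable [set w | c <= `|Z w|] by exact: measurable_norm_ge.
  have := prob_leU mL mM mN sub (lexx _) Pc.
  move=> /(lt_le_trans Pd0).
  pose q := fine (P [set w | d < `|u *m Z w|]).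
  have qE : P [set w | (d < `|u *m Z w|)%R] = q%:E by rewrite fineK // fin_num_measure.
  rewrite qE -EFinD !lte_fin; lra.
move=> h; have [d [d0 hd]] := filter_ex (filterI (nbhs_right_gt (0 : R)) h).
by exists d => // u Su; exact: hd.
Qed.

(** This is the part of the convergence of types theorem that is used: a matrix
    that maps [Z] to something small with large probability is itself small. The
    norm of [A] is reached on one of its rows, to which [linearly_full_uniform]
    applies after normalization. *)
Lemma linearly_full_bound n (Z : T -> 'cV[R]_n.+1) :
  random_mx Z -> linearly_full Z ->
  exists2 d : R, 0 < d & forall (A : 'M[R]_n.+1) (c : R), 0 <= c ->
    (P [set w | (c <= `|A *m Z w|)%R] <= d%:E)%E -> `|A| <= c / d.
Proof.
move=> mZ fZ; have [d d0 hd] := linearly_full_uniform mZ fZ.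
exists d => // A c c0 PA; rewrite leNgt; apply/negP => Ac.
have cd : 0 <= c / d by rewrite divr_ge0 // ltW.
have [[i j] /= Aij] : exists ij, `|A| = `|A ij.1 ij.2|.
  by apply: (@mx_norm_neq0 _ _ _ A); rewrite gt_eqF // (le_lt_trans cd).
set u := row i A.
have uA : `|u| = `|A|.
  apply/eqP; rewrite eq_le; apply/andP; split.
    by apply: mx_norm_le => // k l; rewrite mxE mx_entry_le_norm.
  by rewrite Aij -[X in `|X| <= _](_ : u 0 j = _) ?mx_entry_le_norm // mxE.
have u0 : 0 < `|u| by rewrite uA (le_lt_trans cd).
have h := hd (`|u|^-1 *: u).
rewrite mx_normZ normfV normr_id mulVf ?gt_eqF // in h.
suff hle : (P [set w | (d < `|(`|u|^-1 *: u) *m Z w|)%R] <= d%:E)%E.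
  by have := lt_le_trans (h erefl) hle; rewrite ltxx.
apply: le_trans _ PA; apply: prob_le.
- by apply: measurable_norm_gt; exact: random_mxM.
- by apply: measurable_norm_ge; exact: random_mxM.
move=> w /=; rewrite -scalemxAl mx_normZ normfV normr_id ltr_pdivlMl // => hw.
have : `|u *m Z w| <= `|A *m Z w|.
  by rewrite /u -row_mul norm_mx11 mxE mx_entry_le_norm.
apply: le_trans; apply: ltW; apply: lt_trans hw.
by rewrite -ltr_pdivrMr // uA.
Qed.

End LinearlyFull.

(** * Finite-dimensional laws of random fields *)

Section FiniteDimensionalLaws.
Context {R : realType} {disp : measure_display} {T : measurableType disp}.
Variable P : probability T R.

Definition sample_mx d m (Y : 'cV[R]_d -> T -> 'cV[R]_m) k (t : 'I_k -> 'cV[R]_d)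
  (w : T) : 'M[R]_(m, k) := \matrix_(i, j) Y (t j) w i 0.

Lemma eq_fdd_law d m (Y Z : 'cV[R]_d -> T -> 'cV[R]_m) t :
  eq_fdd P Y Z -> eq_law P (Y t) (Z t).
Proof.
move=> YZ A mA; have := YZ 1%N (fun=> t) A mA; rewrite /fdd /pushforward.
have e (W : 'cV[R]_d -> T -> 'cV[R]_m) :
    (fun w => \matrix_(i, j) W t w i 0 : 'M[R]_(m, 1)) = W t.
  by apply/funext => w; apply/matrixP => i j; rewrite mxE ord1.
by rewrite !e.
Qed.

Lemma eq_fdd_time d d' m (Y Z : 'cV[R]_d -> T -> 'cV[R]_m) (f : 'cV[R]_d' -> 'cV[R]_d) :
  eq_fdd P Y Z -> eq_fdd P (fun t w => Y (f t) w) (fun t w => Z (f t) w).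
Proof. by move=> YZ k t A mA; exact: (YZ k (f \o t)). Qed.

(** An affine map applied to each column is continuous on matrices, so it pulls
    Borel sets back to Borel sets. *)
Lemma eq_fdd_affine d m p (Y Z : 'cV[R]_d -> T -> 'cV[R]_m) (C : 'M[R]_(p, m)) c :
  eq_fdd P Y Z ->
  eq_fdd P (fun t w => C *m Y t w + c) (fun t w => C *m Z t w + c).
Proof.
move=> YZ k t A mA.
pose phi (M : 'M[R]_(m, k)) : 'M[R]_(p, k) := C *m M + \matrix_(i, j) c i 0.
have mphi : measurable (phi @^-1` A : set (@borel_mx R m k)).
  suff : measurable_fun [set: @borel_mx R m k] (phi : _ -> @borel_mx R p k).
    by move=> /(_ measurableT _ mA); rewrite setTI.
  apply: (@measurability _ _ (@borel_mx R m k) (@borel_mx R p k) setT phi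
    (@open 'M[R]_(p, k)) erefl).
  move=> _ [U oU <-]; rewrite setTI; apply: open_measurable_mx.
  apply: open_comp => // M _.
  apply: (@cvgD _ _ _ (nbhs M)); last exact: cvg_cst.
  by apply: cvg_mulmx; [exact: cvg_cst | exact: cvg_id].
have e (W : 'cV[R]_d -> T -> 'cV[R]_m) : fdd P (fun t w => C *m W t w + c) t A =
    fdd P W t (phi @^-1` A).
  rewrite /fdd /pushforward; congr (P (_ @^-1` A)); apply/funext => w.
  apply/matrixP => i j; rewrite !mxE; congr (_ + _).
  by apply: eq_bigr => l _; rewrite !mxE.
by rewrite !e; exact: YZ.
Qed.

Lemma eq_fdd_mul d m p (Y Z : 'cV[R]_d -> T -> 'cV[R]_m) (C : 'M[R]_(p, m)) :
  eq_fdd P Y Z -> eq_fdd P (fun t w => C *m Y t w) (fun t w => C *m Z t w).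
Proof.
move=> /(eq_fdd_affine C 0).
by under eq_fun do under eq_fun do rewrite addr0;
   under [X in eq_fdd _ _ X]eq_fun do under eq_fun do rewrite addr0.
Qed.

Lemma random_sample_mx d m (Y : 'cV[R]_d -> T -> 'cV[R]_m) k (t : 'I_k -> 'cV[R]_d) :
  random_field Y -> random_mx (sample_mx Y t).
Proof.
move=> mY; apply/random_mxP => i j; rewrite /sample_mx.
under eq_fun do rewrite mxE.
by have /random_mxP/(_ i 0) := mY (t j).
Qed.

Lemma sample_mxM d m p (Y : 'cV[R]_d -> T -> 'cV[R]_m) (C : 'M[R]_(p, m)) k
    (t : 'I_k -> 'cV[R]_d) w :
  sample_mx (fun t w => C *m Y t w) t w = C *m sample_mx Y t w.
Proof.
by apply/matrixP => i j; rewrite !mxE; apply: eq_bigr => l _; rewrite !mxE.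
Qed.

Lemma prob_finite_union k (A : 'I_k -> set T) (B : set T) (c : R) :
  0 <= c -> measurable B -> (forall j, measurable (A j)) ->
  (forall j, (P (A j) <= c%:E)%E) -> (forall w, B w -> exists j, A j w) ->
  (P B <= (k%:R * c)%:E)%E.
Proof.
move=> c0; elim: k A B => [|k IH] A B mB mA PA BA.
  rewrite mul0r (_ : B = set0) ?measure0 //.
  by apply/seteqP; split => // w /BA[[]].
pose B' := \bigcup_(j : 'I_k) A (lift ord0 j).
have mB' : measurable B'.
  by apply: countable_bigcupT_measurable => //; exact: countableP.
rewrite -natr1 mulrDl mul1r EFinD.
apply: (prob_leU mB mB' (mA ord0) _ _ (PA ord0)).
  move=> w /BA[j]; case: (unliftP ord0 j) => [j' ->|->] Aw; last by right.
  by left; exists j'.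
apply: (IH (fun j => A (lift ord0 j))) => //.
by move=> w [j _ Aw]; exists j.
Qed.

Lemma stochastically_continuous_near d m (Y : 'cV[R]_d -> T -> 'cV[R]_m) t e eta :
  stochastically_continuous P Y -> 0 < e -> 0 < eta ->
  \forall s \near t, (P [set w | (e <= `|Y s w - Y t w|)%R] <= eta%:E)%E.
Proof.
move=> cY e0 eta0; have h := cY t e e0.
have nb : nbhs (0%E : \bar R) [set y | (y < eta%:E)%E].
  apply: open_nbhs_nbhs; split; last by rewrite /= lte_fin.
  exact: open_ereal_lt_ereal.
have h1 : \forall s \near t, (P [set w | (e <= `|Y s w - Y t w|)%R] < eta%:E)%E := h _ nb.
by apply: filterS h1 => s /ltW.
Qed.

End FiniteDimensionalLaws.

(** * The group of scaling matrices of a random field *)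

Section ScalingGroup.
Context {R : realType} {disp : measure_display} {T : measurableType disp}.
Variable P : probability T R.
Variables (d n : nat) (Y : 'cV[R]_d.+1 -> T -> 'cV[R]_n.+1) (E : 'M[R]_d.+1).

Hypothesis Yrand : random_field Y.
Hypothesis Ycont : stochastically_continuous P Y.
Hypothesis Yfull : forall t, t != 0 -> linearly_full P (Y t).

Local Notation ones := (const_mx 1 : 'cV[R]_d.+1).

Definition scaling (x : R) (A : 'M[R]_n.+1) : Prop :=
  eq_fdd P (fun t w => Y (expmx (x *: E) *m t) w) (fun t w => A *m Y t w).

Lemma scaling_mul x y A B : scaling x A -> scaling y B -> scaling (x + y) (A * B).
Proof.
move=> GA GB k t S mS.
have e1 := eq_fdd_time (fun t => expmx (y *: E) *m t) GA t mS.
have e2 := eq_fdd_mul A GB t mS.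
have e3 : (fun t w => Y (expmx ((x + y) *: E) *m t) w) =
   (fun t w => Y (expmx (x *: E) *m (expmx (y *: E) *m t)) w).
  by apply/funext => s; rewrite expmxZD -mulmxE mulmxA.
have e4 : (fun t w => (A * B) *m Y t w) = (fun t w => A *m (B *m Y t w)).
  by apply/funext => s; apply/funext => w; rewrite -mulmxE mulmxA.
by rewrite e3 e4 e1 e2.
Qed.

Lemma expmx_mul_neq0 x (t : 'cV[R]_d.+1) : t != 0 -> expmx (x *: E) *m t != 0.
Proof.
apply: contra => /eqP h; have := expmxZN E (- x); rewrite opprK -mulmxE => e.
by rewrite -[t]mul1mx -[1%:M]e -mulmxA h mulmx0.
Qed.

Lemma nonzero_time : ones != 0.
Proof.
by apply/eqP => /matrixP/(_ 0 0); rewrite !mxE => /eqP; rewrite oner_eq0.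
Qed.

(** A row that kills [A] would also kill the full random vector
    [Y (expmx (x *: E) *m t)]. *)
Lemma scaling_unit x A : scaling x A -> A \is a GRing.unit.
Proof.
move=> GA; rewrite -[_ \is a _]/(A \in unitmx) -row_free_unit -kermx_eq0.
apply/negPn/negP => /matrix0Pn[i [j kij]].
set u := row i (kermx A).
have u0 : u != 0.
  by apply/eqP => /rowP/(_ j); rewrite [LHS]mxE [RHS]mxE => h; rewrite h eqxx in kij.
have uA : u *m A = 0 by rewrite /u -row_mul mulmx_ker row0.
have := Yfull (expmx_mul_neq0 x nonzero_time) u0; apply/negP/negPn/eqP.
have mS : measurable ([set M | u *m M != 0] : set (@borel_mx R n.+1 1)).
  apply: open_measurable_mx; have := @open_affine_neq0 R _ u 0.
  by under eq_fun do rewrite addr0.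
have := eq_fdd_law ones GA mS; rewrite /preimage /= => ->.
rewrite (_ : [set w | _] = set0) ?measure0 //.
by apply/seteqP; split => // w /=; rewrite mulmxA uA mul0mx eqxx.
Qed.

Lemma scaling_inv x A : scaling x A -> A \is a GRing.unit /\ scaling (- x) A^-1.
Proof.
move=> GA; have uA := scaling_unit GA; split => // k t S mS.
have e1 := eq_fdd_mul A^-1 (eq_fdd_time (fun t => expmx (- x *: E) *m t) GA) t mS.
have e2 : (fun t w => A^-1 *m (A *m Y (expmx (- x *: E) *m t) w)) =
    (fun t w => Y (expmx (- x *: E) *m t) w).
  by apply/funext => s; apply/funext => w; rewrite mulmxA mulmxE mulVr // mul1mx.
have e3 : (fun t w => A^-1 *m Y (expmx (x *: E) *m (expmx (- x *: E) *m t)) w) =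
    (fun t w => A^-1 *m Y t w).
  by apply/funext => s; rewrite mulmxA mulmxE expmxZN mul1mx.
by rewrite e2 e3 in e1; rewrite e1.
Qed.

(** Along the filter, [A *m Y ones] has the law of [Y (expmx (x i *: E) *m ones)],
    which is close to [Y t1] in probability; so a bound on [Y t1] gives a bound on
    [A] through [linearly_full_bound]. *)
Lemma scaling_bound_along I (F : set_system I) (FF : Filter F) (x : I -> R)
    (t1 : 'cV[R]_d.+1) :
  expmx (x i *: E) *m ones @[i --> F] --> t1 ->
  exists2 dl : R, 0 < dl & forall c e, 0 <= c -> 0 < e ->
    (P [set w | (c <= `|Y t1 w|)%R] <= (dl / 2)%:E)%E ->
    \forall i \near F, forall A, scaling (x i) A -> `|A| <= (c + e) / dl.
Proof.
move=> xt; have [dl dl0 hdl] := linearly_full_bound (Yrand _) (Yfull nonzero_time).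
exists dl => // c e c0 e0 Pc.
have dl20 : 0 < dl / 2 by rewrite divr_gt0.
have near1 : \forall i \near F,
    (P [set w | (e <= `|Y (expmx (x i *: E) *m ones) w - Y t1 w|)%R] <= (dl / 2)%:E)%E.
  exact: xt _ (stochastically_continuous_near t1 Ycont e0 dl20).
apply: filterS near1 => i Pi A GA; apply: hdl; first by rewrite addr_ge0 // ltW.
have mS : measurable ([set M | c + e <= `|M|] : set (@borel_mx R n.+1 1)).
  have -> : [set M : 'cV[R]_n.+1 | c + e <= `|M|] = ~` [set M | `|M| < c + e].
    by apply/seteqP; split => M /=; rewrite leNgt => /negP.
  apply: measurableC; apply: open_measurable_mx; exact: open_norm_lt.
have := eq_fdd_law ones GA mS; rewrite /preimage /= => <-.
rewrite [dl]splitr EFinD; apply: (prob_leU _ _ _ _ Pc Pi).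
- exact: (measurable_norm_ge _ (Yrand _)).
- exact: (measurable_norm_ge _ (Yrand _)).
- by apply: measurable_norm_ge; apply: random_mxB; exact: Yrand.
move=> w /= h; have [h1|h1] := ltP (`|Y t1 w|) c; [right|by left].
rewrite leNgt; apply/negP => h2; move: h; apply/negP; rewrite -ltNge.
rewrite -[X in `|X|](subrK (Y t1 w)) addrC.
by apply: le_lt_trans (ler_normD _ _) _; rewrite ltrD.
Qed.

Lemma scaling_bounded_along I (F : set_system I) (FF : Filter F) (x : I -> R)
    (t1 : 'cV[R]_d.+1) :
  expmx (x i *: E) *m ones @[i --> F] --> t1 ->
  exists c, \forall i \near F, forall A, scaling (x i) A -> `|A| <= c.
Proof.
move=> xt; have [dl dl0 h] := scaling_bound_along FF xt.
have dl20 : 0 < dl / 2 by rewrite divr_gt0.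
have [c c0 Pc] := random_mx_tight P dl20 (Yrand t1).
by exists ((c + 1) / dl); apply: h.
Qed.

Lemma scaling_vanishing_along I (F : set_system I) (FF : Filter F) (x : I -> R)
    (t1 : 'cV[R]_d.+1) :
  expmx (x i *: E) *m ones @[i --> F] --> t1 ->
  P [set w | Y t1 w != 0] = 0%E ->
  forall e, 0 < e -> \forall i \near F, forall A, scaling (x i) A -> `|A| <= e.
Proof.
move=> xt Y0 e e0; have [dl dl0 h] := scaling_bound_along FF xt.
have ed0 : 0 < e * dl / 2 by rewrite divr_gt0 // mulr_gt0.
have -> : e = (e * dl / 2 + e * dl / 2) / dl.
  by rewrite -splitr mulfK // gt_eqF.
apply: h => //; first exact: ltW.
apply: (@le_trans _ _ 0%E); last by rewrite lee_fin divr_ge0 // ltW.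
rewrite -Y0; apply: prob_le.
- exact: (measurable_norm_ge _ (Yrand _)).
- rewrite (_ : [set w | _] = [set w | 0 < `|Y t1 w|]).
    exact: (measurable_norm_gt _ (Yrand _)).
  by apply/seteqP; split => w /=; rewrite normr_gt0.
- by move=> w /= hw; rewrite -normr_gt0; exact: lt_le_trans hw.
Qed.

(** Both sides of the equality in law depend continuously in probability on
    [(x, A)]: the left-hand side by stochastic continuity of the field, the
    right-hand side by tightness of the sampled values. *)
Lemma scaling_closed x A :
  (forall e, 0 < e -> exists y B, [/\ scaling y B, `|x - y| < e & `|A - B| < e]) ->
  scaling x A.
Proof.
move=> H k t.
pose U := sample_mx Y (fun j => expmx (x *: E) *m t j).
pose V w := A *m sample_mx Y t w.
suff UV : eq_law P U V.
  move=> S mS; have := UV S mS; rewrite /fdd /pushforward => ->.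
  by congr (P (_ @^-1` S)); apply/funext => w; rewrite /V -sample_mxM.
have mU : random_mx U by exact: random_sample_mx.
have ms : random_mx (sample_mx Y t) by exact: random_sample_mx.
have mV : random_mx V by exact: random_mxM.
have app (e : R) : 0 < e -> exists U' V', [/\ random_mx U', random_mx V', eq_law P U' V',
    (P [set w | (e <= `|U w - U' w|)%R] <= e%:E)%E &
    (P [set w | (e <= `|V w - V' w|)%R] <= e%:E)%E].
  move=> e0.
  have ek0 : 0 < e / k.+1%:R by rewrite divr_gt0.
  pose close j : set R := [set y |
    (P [set w | (e <= `|Y (expmx (y *: E) *m t j) w - Y (expmx (x *: E) *m t j) w|)%R]
      <= (e / k.+1%:R)%:E)%E].
  have nearx : \forall y \near x, forall j : 'I_k, close j y.
    apply: (@filter_forall _ _ close (nbhs x)) => j.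
    have c : expmx (y *: E) *m t j @[y --> x] --> expmx (x *: E) *m t j.
      apply: cvg_mulmx; last exact: cvg_cst.
      exact: cvg_expmx_scale.
    exact: c _ (stochastically_continuous_near _ Ycont e0 ek0).
  have /nbhs_ballP[r r0 hr] := nearx.
  have [c c0 Pc] := random_mx_tight P e0 ms.
  have nc0 : 0 < n.+1%:R * c + 1 by rewrite ltr_wpDl // mulr_ge0.
  (* On the event where the sample is below [c], the second bound makes
     [(A - B) *m sample] smaller than [e]. *)
  pose dl := Num.min r (e / (n.+1%:R * c + 1)).
  have dl0 : 0 < dl by rewrite lt_min r0 divr_gt0.
  have [y [B [GB xy AB]]] := H _ dl0.
  rewrite lt_min in xy; rewrite lt_min in AB.
  move/andP : xy => [xy _]; move/andP : AB => [_ AB].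
  pose U' := sample_mx Y (fun j => expmx (y *: E) *m t j).
  pose V' w := B *m sample_mx Y t w.
  have mU' : random_mx U' by exact: random_sample_mx.
  have mV' : random_mx V' by exact: random_mxM.
  exists U', V'; split => //.
  - move=> S mS; have := GB k t S mS; rewrite /fdd /pushforward => ->.
    by congr (P (_ @^-1` S)); apply/funext => w; rewrite /V' -sample_mxM.
  - apply: (@le_trans _ _ (k%:R * (e / k.+1%:R))%:E); last first.
      rewrite lee_fin mulrCA ler_piMr ?(ltW e0) //.
      by rewrite ler_pdivrMr ?ltr0n // mul1r ler_nat.
    apply: (prob_finite_union _ _ _ (hr y xy)); first exact: ltW.
    + by apply: measurable_norm_ge; exact: random_mxB.
    + by move=> j; apply: measurable_norm_ge; apply: random_mxB; exact: Yrand.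
    + move=> w /= he; apply: contrapT => nj.
      move: he; apply/negP; rewrite -ltNge; apply: mx_norm_lt => // i j.
      have hj : `|Y (expmx (y *: E) *m t j) w - Y (expmx (x *: E) *m t j) w| < e.
        by rewrite ltNge; apply/negP => h; apply: nj; exists j.
      rewrite !mxE distrC; apply: le_lt_trans hj.
      by apply: le_trans (mx_entry_le_norm _ i 0); rewrite !mxE.
  - apply: le_trans Pc; apply: prob_le.
    + by apply: measurable_norm_ge; exact: random_mxB.
    + exact: measurable_norm_ge.
    + move=> w /=; rewrite /V /V' -mulmxBl => he.
      rewrite leNgt; apply/negP => hc; move: he; apply/negP; rewrite -ltNge.
      apply: le_lt_trans (norm_mulmx _ _) _.
      have h1 : n.+1%:R * `|A - B| * `|sample_mx Y t w| <= n.+1%:R * `|A - B| * c.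
        by rewrite ler_wpM2l ?mulr_ge0 // ltW.
      apply: le_lt_trans h1 _; rewrite ltr_pdivlMr // in AB.
      apply: le_lt_trans AB.
      by rewrite mulrAC mulrC ler_wpM2l // lerDl.
have appC (e : R) : 0 < e -> exists V' U', [/\ random_mx V', random_mx U', eq_law P V' U',
    (P [set w | (e <= `|V w - V' w|)%R] <= e%:E)%E &
    (P [set w | (e <= `|U w - U' w|)%R] <= e%:E)%E].
  move=> /app[U' [V' [h1 h2 h3 h4 h5]]]; exists V', U'; split => // S mS.
  by rewrite h3.
apply: eq_law_closed => // F cF; apply/eqP; rewrite eq_le; apply/andP; split.
- exact: limit_law_le.
- exact: limit_law_le.
Qed.

Hypothesis Eoss : forall x, exists A, scaling x A.
Hypothesis Edecay : expmx (- s *: E) @[s --> +oo] --> (0 : 'M[R]_d.+1).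

(** The scaling matrices form a closed graded group, which provides [D]. Since
    [expmx (- s *: E)] tends to [0], the field at [expmx (- s *: E) *m ones]
    converges to its value at the origin, which keeps [expmx (- s *: D)] bounded. *)
Lemma scaling_exponent : exists D, (forall x, scaling x (expmx (x *: D))) /\
  exists c, \forall s \near +oo, `|expmx (- s *: D)| <= c.
Proof.
have [D HD] : exists D, forall x, scaling x (expmx (x *: D)).
  apply: graded_group_exponent.
  - exact: Eoss.
  - exact: scaling_mul.
  - exact: scaling_inv.
  - have c0 : expmx (x *: E) *m ones @[x --> (0 : R)] --> expmx (0 *: E) *m ones.
      by apply: cvg_mulmx; [exact: cvg_expmx_scale | exact: cvg_cst].
    exact: (@scaling_bounded_along _ _ _ id _ c0).
  - exact: scaling_closed.
exists D; split => //.
have [c hc] : exists c, \forall s \near +oo, forall A, scaling (- s) A -> `|A| <= c.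
  have c0 : expmx (- s *: E) *m ones @[s --> +oo] --> (0 : 'M[R]_d.+1) *m ones.
    by apply: cvg_mulmx; [exact: Edecay | exact: cvg_cst].
  exact: (@scaling_bounded_along _ _ _ -%R _ c0).
by exists c; apply: filterS hc => s; exact.
Qed.

(** At the origin, [Y 0] has the law of [expmx (- s *: D) *m Y 0], which tends to
    [0] if the exponential does. Conversely, if [Y 0] vanishes then
    [expmx (- s *: D) *m Y ones] tends to [0] in probability and fullness carries
    this over to the matrix. *)
Lemma scaling_decay D : (forall x, scaling x (expmx (x *: D))) ->
  expmx (- s *: D) @[s --> +oo] --> (0 : 'M[R]_n.+1) <-> P [set w | Y 0 w != 0] = 0%E.
Proof.
move=> HD; split => [dec|Y0]; last first.
  apply/cvgrPdist_le => e e0.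
  have xt : expmx (- s *: E) *m ones @[s --> +oo] --> (0 : 'M[R]_d.+1) *m ones.
    by apply: cvg_mulmx; [exact: Edecay | exact: cvg_cst].
  rewrite mul0mx in xt.
  have h : \forall s \near +oo, forall A, scaling (- s) A -> `|A| <= e.
    exact: (@scaling_vanishing_along _ _ _ -%R _ xt Y0 _ e0).
  by apply: filterS h => s h; rewrite sub0r normrN; exact: h.
have Ye e : 0 < e -> P [set w | e <= `|Y 0 w|] = 0%E.
  move=> e0; apply/eqP; rewrite eq_le measure_ge0 andbT.
  apply/lee_addgt0Pr => eta eta0; rewrite add0e.
  have [c c0 Pc] := random_mx_tight P eta0 (Yrand 0).
  have nc0 : 0 < n.+1%:R * c + 1 by rewrite ltr_wpDl // mulr_ge0.
  have d0 : 0 < e / (n.+1%:R * c + 1) by rewrite divr_gt0.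
  have /cvgrPdist_lt/(_ _ d0)/filter_ex[s] := dec.
  rewrite sub0r normrN ltr_pdivlMr // => hs.
  have mS : measurable ([set M | e <= `|M|] : set (@borel_mx R n.+1 1)).
    have -> : [set M : 'cV[R]_n.+1 | e <= `|M|] = ~` [set M | `|M| < e].
      by apply/seteqP; split => M /=; rewrite leNgt => /negP.
    by apply: measurableC; apply: open_measurable_mx; exact: open_norm_lt.
  have := eq_fdd_law 0 (HD (- s)) mS; rewrite /preimage /= mulmx0 => ->.
  apply: le_trans Pc; apply: prob_le.
  - by apply: measurable_norm_ge; apply: random_mxM; exact: Yrand.
  - exact: (measurable_norm_ge _ (Yrand _)).
  move=> w /= he; rewrite leNgt; apply/negP => hc; move: he; apply/negP; rewrite -ltNge.
  apply: le_lt_trans (norm_mulmx _ _) _.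
  apply: le_lt_trans (ler_wpM2l _ (ltW hc)) _; first by rewrite mulr_ge0.
  apply: le_lt_trans hs.
  by rewrite mulrAC mulrC ler_wpM2l // lerDl.
have mge i : measurable [set w | i.+1%:R^-1 <= `|Y 0 w|].
  exact: (measurable_norm_ge _ (Yrand _)).
have mgt : measurable [set w | 0 < `|Y 0 w|].
  exact: (measurable_norm_gt _ (Yrand _)).
have -> : [set w | Y 0 w != 0] = [set w | 0 < `|Y 0 w|].
  by apply/seteqP; split => w /=; rewrite normr_gt0.
apply: (iffLR (@negligibleP _ _ _ P _ mgt)).
have : P.-negligible (\bigcup_i [set w | i.+1%:R^-1 <= `|Y 0 w|]).
  by apply: negligible_bigcup => i; apply: (iffRL (@negligibleP _ _ _ P _ (mge i))); exact: Ye.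
apply: negligibleS => w /= Y0; exists (Num.truncn (`|Y 0 w|^-1)) => //=.
rewrite -[leRHS]invrK lef_pV2 ?posrE ?invr_gt0 //.
by apply: ltW; exact: truncnS_gt.
Qed.

End ScalingGroup.

(** * Affine scalings made linear *)

Section Homogenization.
Context {R : realType} {disp : measure_display} {T : measurableType disp}.
Variable P : probability T R.

(** If [v *m Z + c] vanished almost surely, its zero set, a closed hyperplane,
    would contain the support. *)
Lemma full_affine m (Z : T -> 'cV[R]_m) (v : 'rV[R]_m) (c : 'M[R]_1) :
  full (pushforward P (Z : T -> @borel_mx R m 1)) -> v != 0 ->
  P [set w | v *m Z w + c != 0] != 0%E.
Proof.
move=> fZ v0; apply/eqP => P0.
apply: (fZ v^T (- c 0 0)); first by rewrite trmx_eq0.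
move=> x sx; rewrite /hyperplane /=.
have e (y : 'cV[R]_m) : (v *m y + c == 0) = (\sum_i v^T i 0 * y i 0 == - c 0 0).
  rewrite -addr_eq0; apply/eqP/eqP => [/matrixP/(_ 0 0)|h].
    by rewrite !mxE => h; rewrite -[RHS]h; congr (_ + _); apply: eq_bigr => i _; rewrite mxE.
  apply/matrixP => i j; rewrite !ord1 !mxE -[RHS]h; congr (_ + _).
  by apply: eq_bigr => l _; rewrite mxE.
apply/eqP; rewrite -e; apply/negPn/negP => nx.
pose U := [set y : 'cV[R]_m | v *m y + c != 0].
have oU : open U by exact: open_affine_neq0.
have := sx U oU nx; rewrite /pushforward.
by rewrite (_ : _ @^-1` _ = [set w | v *m Z w + c != 0]) // P0 ltxx.
Qed.

Lemma full_linearly_full m (Z : T -> 'cV[R]_m) :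
  full (pushforward P (Z : T -> @borel_mx R m 1)) -> linearly_full P Z.
Proof.
move=> fZ u u0; have := full_affine 0 fZ u0.
by under eq_fun do rewrite addr0.
Qed.

(** The extra coordinate [1] turns an affine map [B *m x + a] into the block matrix
    with rows [1 0] and [a B]. *)
Definition homogenize d m (X : 'cV[R]_d -> T -> 'cV[R]_m) t w : 'cV[R]_(1 + m) :=
  col_mx 1%:M (X t w).

Lemma random_field_homogenize d m (X : 'cV[R]_d -> T -> 'cV[R]_m) :
  random_field X -> random_field (homogenize X).
Proof.
move=> mX t; apply/random_mxP => i j; rewrite /homogenize.
case: (split_ordP i) => k ->.
  by under eq_fun do rewrite col_mxEu; exact: measurable_cst.
under eq_fun do rewrite col_mxEd.
by have /random_mxP/(_ k j) := mX t.
Qed.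

Lemma stochastically_continuous_homogenize d m (X : 'cV[R]_d -> T -> 'cV[R]_m) :
  stochastically_continuous P X -> stochastically_continuous P (homogenize X).
Proof.
move=> cX t e e0.
have E s : [set w | e <= `|homogenize X s w - homogenize X t w|] =
    [set w | e <= `|X s w - X t w|].
  apply/seteqP; split => w /=; rewrite /homogenize opp_col_mx add_col_mx subrr.
    apply: contraTT; rewrite -!ltNge => h; apply: mx_norm_lt => // i j.
    case: (split_ordP i) => k ->; first by rewrite col_mxEu mxE normr0.
    by rewrite col_mxEd; apply: le_lt_trans h; exact: mx_entry_le_norm.
  move=> h; apply: le_trans h _; apply: mx_norm_le => // i j.
  by rewrite -(col_mxEd (0 : 'M[R]_(1, 1))) mx_entry_le_norm.
under eq_cvg do rewrite E.
exact: cX.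
Qed.

Lemma linearly_full_homogenize d m (X : 'cV[R]_d -> T -> 'cV[R]_m) t :
  full (pushforward P (X t : T -> @borel_mx R m 1)) ->
  linearly_full P (homogenize X t).
Proof.
move=> fX u; rewrite -[u]hsubmxK; set a := lsubmx u; set v := rsubmx u => u0.
have E w : row_mx a v *m homogenize X t w = v *m X t w + a.
  by rewrite /homogenize mul_row_col mulmx1 addrC.
under eq_fun do rewrite E.
have [v0|v0] := eqVneq v 0; last exact: full_affine.
have a0 : a != 0.
  by apply: contra u0 => /eqP ->; rewrite v0 row_mx0.
rewrite (_ : [set w | _] = setT) ?probability_setT ?oner_eq0 //.
by apply/seteqP; split => // w _ /=; rewrite v0 mul0mx add0r.
Qed.

End Homogenization.

(** * Block form of a homogenized exponent *)

Section HomogeneousExponent.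
Variables (R : realType) (m : nat) (D : 'M[R]_(1 + m.+1)).

Hypothesis D_top : forall x, usubmx (expmx (x *: D) : 'M[R]_(1 + m.+1)) = row_mx 1%:M 0.

(** The exponent is the derivative at [0] of its one-parameter group, whose top
    row is constant. *)
Lemma exponent_top0 : usubmx D = 0.
Proof.
have c1 : h^-1 *: (expmx (h *: D) - 1) @[h --> (0 : R)^'] --> D.
  apply: cvg_expmx_slope; first by apply: cvg_within_filter; exact: cvg_id.
  exact: nbhs_dnbhs_neq.
apply/matrixP => i j.
have c2 := (cvg_mxP _ _ _).1 c1 (lshift m.+1 i) j.
have c3 : (h^-1 *: (expmx (h *: D) - 1)) (lshift m.+1 i) j @[h --> (0 : R)^'] --> (0 : R).
  apply: cvg_near_cst; apply: nearW => h.
  have e0 : usubmx (1 : 'M[R]_(1 + m.+1)) = row_mx 1%:M 0.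
    by rewrite -(D_top 0) scale0r expmx0.
  have /matrixP/(_ i j) : usubmx (expmx (h *: D) : 'M[R]_(1 + m.+1)) =
      usubmx (1 : 'M[R]_(1 + m.+1)).
    by rewrite D_top e0.
  by rewrite !mxE => ->; rewrite subrr mulr0.
have h : D (lshift m.+1 i) j = 0 by exact: (cvg_unique _ (c2 _) c3).
by rewrite mxE h mxE.
Qed.

(** Matrices with zero top right block multiply diagonally blockwise. *)
Lemma drsubmx_exp k : drsubmx (D ^+ k : 'M[R]_(1 + m.+1)) = drsubmx D ^+ k.
Proof.
have ur0 : ursubmx D = 0 by rewrite /ursubmx exponent_top0 -[0]row_mx0 row_mxKr.
elim: k => [|k IH]; first by apply/matrixP => a b; rewrite !expr0 !mxE eq_shift.
have dr_mul (A B : 'M[R]_(1 + m.+1)) :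
    drsubmx (A *m B) = dlsubmx A *m ursubmx B + drsubmx A *m drsubmx B.
  by rewrite -{1}[A]submxK -{1}[B]submxK mulmx_block block_mxKdr.
by rewrite !exprSr -IH -mulmxE dr_mul ur0 mulmx0 add0r.
Qed.

Lemma drsubmx_expmx x : drsubmx (expmx (x *: D) : 'M[R]_(1 + m.+1)) = expmx (x *: drsubmx D).
Proof.
apply/matrixP => i j.
have c1 := (cvg_mxP _ _ _).1 (@cvg_expmx _ _ (x *: D)) (rshift 1 i) (rshift 1 j).
have c2 := (cvg_mxP _ _ _).1 (@cvg_expmx _ _ (x *: drsubmx D)) i j.
suff c3 : series (expmx_coeff (x *: drsubmx D)) k i j @[k --> \oo] -->
    expmx (x *: D) (rshift 1 i) (rshift 1 j).
  by rewrite !mxE; exact: (cvg_unique _ c3 (c2 _)).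
apply: (cvg_trans _ (c1 _)); apply: near_eq_cvg; apply: nearW => k.
rewrite /series /= !summxE; apply: eq_bigr => l _.
rewrite /expmx_coeff !exprZn !scalerA.
have /matrixP/(_ i j) := drsubmx_exp l; rewrite !mxE => ->.
by [].
Qed.

End HomogeneousExponent.

(** * Exponents of operator-self-similar fields *)

Lemma expmx_powmx (R : realType) n (E : 'M[R]_n.+1) x : expmx (x *: E) = powmx (expR x) E.
Proof. by rewrite powmxE expRK. Qed.

Lemma cvg_powmx (R : realType) n (D : 'M[R]_n.+1) (r : R) : 0 < r ->
  powmx s D @[s --> r] --> powmx r D.
Proof.
move=> r0; rewrite powmxE; under eq_cvg do rewrite powmxE.
have lnr : ln s @[s --> r] --> ln r by exact: continuous_ln.
exact: (cvg_comp _ _ lnr (@cvg_expmx_scale R _ D (ln r))).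
Qed.

Section OperatorScaling.
Context {R : realType} {disp : measure_display} {T : measurableType disp}.
Variable P : probability T R.
Variables (d m : nat) (X : 'cV[R]_d.+1 -> T -> 'cV[R]_m.+1) (E : 'M[R]_d.+1).

Hypothesis X_field : random_field X.
Hypothesis X_cont : stochastically_continuous P X.
Hypothesis X_proper : proper_field P X.
Hypothesis QE : Qmx E.

Let Edecay : expmx (- s *: E) @[s --> +oo] --> (0 : 'M[R]_d.+1).
Proof. by apply: expmx_decay; case: QE. Qed.

Lemma ae_eq0P (Z : T -> 'cV[R]_m.+1) : random_mx Z ->
  {ae P, forall w, Z w = 0} <-> P [set w | Z w != 0] = 0%E.
Proof.
move=> mZ.
have E0 : [set w | Z w != 0] = [set w | 0 < `|Z w|].
  by apply/seteqP; split => w /=; rewrite normr_gt0.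
have mS : measurable [set w | Z w != 0] by rewrite E0; exact: measurable_norm_gt.
have <- : ~` [set w | Z w = 0] = [set w | Z w != 0].
  by apply/seteqP; split => w /= /eqP.
have mS' : measurable (~` [set w | Z w = 0]).
  by rewrite (_ : ~` _ = [set w | Z w != 0]) //; apply/seteqP; split => w /= /eqP.
exact: (@negligibleP _ _ _ P _ mS').
Qed.

Lemma oss_exponent : oss P X E ->
  exists D : 'M[R]_m.+1,
    [/\ Mmx D,
        (forall r : R, 0 < r ->
           eq_fdd P (fun t w => X (powmx r E *m t) w) (fun t w => powmx r D *m X t w))
      & (Qmx D <-> {ae P, forall w, X 0 w = 0})].
Proof.
move=> ossX.
have Xfull t : t != 0 -> linearly_full P (X t).
  by move=> t0; apply: full_linearly_full; exact: X_proper.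
have Xoss x : exists A, scaling P X E x A.
  by have [B HB] := ossX (expR x) (expR_gt0 x); exists B; rewrite /scaling expmx_powmx.
have [D [HD [c Dc]]] := scaling_exponent X_field X_cont Xfull Xoss Edecay.
exists D; split; first exact: Mmx_of_bounded Dc.
  by move=> r r0; rewrite !powmxE; exact: HD.
have dec := scaling_decay X_field X_cont Xfull Edecay HD.
have ae := ae_eq0P (X_field 0).
split; first by move=> [_ QD]; apply/ae/dec; exact: expmx_decay.
by move=> /ae/dec; exact: Qmx_of_decay.
Qed.

(** Applied to the homogenized field, [scaling_exponent] gives an exponent [D] one
    size larger. The first coordinate of the field is constantly [1], so fullness
    forces the first row of every [expmx (x *: D)] to be [1 0]; the lower right block
    of [D] is then the exponent of the field, and the lower left block of
    [powmx r D] is the translation part. *)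
Lemma oss_HM_exponent : oss_HM P X E ->
  exists (D : 'M[R]_m.+1) (b : R -> 'cV[R]_m.+1),
    [/\ Mmx D,
        {within `]0, +oo[, continuous b}
      & (forall r : R, 0 < r ->
           eq_fdd P (fun t w => X (powmx r E *m t) w)
                    (fun t w => powmx r D *m X t w + b r))].
Proof.
move=> ossX; pose Y := homogenize X.
have Y_field : random_field Y by exact: random_field_homogenize.
have Y_cont : stochastically_continuous P Y by exact: stochastically_continuous_homogenize.
have Yfull t : t != 0 -> linearly_full P (Y t).
  by move=> t0; apply: linearly_full_homogenize; exact: X_proper.
have Yoss x : exists A, scaling P Y E x A.
  have [B [a HBa]] := ossX (expR x) (expR_gt0 x).
  exists (block_mx 1%:M 0 a B); rewrite /scaling expmx_powmx.
  have := eq_fdd_affine (col_mx 0 1%:M : 'M[R]_(1 + m.+1, m.+1)) (col_mx 1%:M 0) HBa.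
  have -> : (fun t w => col_mx 0 1%:M *m X (powmx (expR x) E *m t) w + col_mx 1%:M 0) =
      (fun t w => Y (powmx (expR x) E *m t) w).
    apply/funext => t; apply/funext => w.
    by rewrite mul_col_mx mul0mx mul1mx add_col_mx add0r addr0.
  have -> // : (fun t w => col_mx 0 1%:M *m (B *m X t w + a) + col_mx 1%:M 0) =
      (fun t w => block_mx 1%:M 0 a B *m Y t w).
  apply/funext => t; apply/funext => w.
  rewrite mul_col_mx mul0mx mul1mx add_col_mx add0r addr0.
  by rewrite /Y /homogenize mul_block_col mul1mx mul0mx addr0 mulmx1 addrC.
have [D [HD [c Dc]]] := scaling_exponent Y_field Y_cont Yfull Yoss Edecay.
have Dtop x : usubmx (expmx (x *: D) : 'M[R]_(1 + m.+1)) = row_mx 1%:M 0.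
  set M := expmx (x *: D) : 'M[R]_(1 + m.+1).
  pose e0 : 'rV[R]_(1 + m.+1) := row_mx 1%:M 0.
  have e0Y t w : e0 *m Y t w = 1%:M by rewrite mul_row_col mulmx1 mul0mx addr0.
  have e0M : e0 *m M = usubmx M.
    by rewrite -{1}[M]vsubmxK mul_row_col mul1mx mul0mx addr0.
  apply/eqP; rewrite -subr_eq0; apply/negPn/negP => u0.
  have := Yfull _ (nonzero_time d) _ u0; apply/negP/negPn/eqP.
  have mS : measurable ([set y | e0 *m y - 1%:M != 0] : set (@borel_mx R (1 + m.+1) 1)).
    apply: open_measurable_mx; exact: open_affine_neq0.
  have := eq_fdd_law (const_mx 1) (HD x) mS; rewrite /preimage /=.
  have -> : [set w | e0 *m Y (expmx (x *: E) *m const_mx 1) w - 1%:M != 0] = set0.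
    by apply/seteqP; split => // w /=; rewrite e0Y subrr eqxx.
  rewrite measure0 => h; rewrite [RHS]h; congr (P _).
  by apply/seteqP; split => w /=; rewrite mulmxBl e0Y mulmxA e0M.
pose D' := drsubmx (D : 'M[R]_(1 + m.+1)).
pose b r : 'cV[R]_m.+1 := dlsubmx (powmx r D : 'M[R]_(1 + m.+1)).
exists D', b; split.
- apply: (@Mmx_of_bounded _ _ _ c); apply: filterS Dc => s; apply: le_trans.
  rewrite -(drsubmx_expmx Dtop); apply: mx_norm_le => // i j.
  by rewrite !mxE; exact: mx_entry_le_norm.
- apply: continuous_in_subspaceT => r; rewrite inE /= in_itv /= andbT => r0.
  apply/cvg_mxP => i j; rewrite /b.
  under eq_cvg do rewrite !mxE.
  rewrite !mxE.
  have h := (cvg_mxP _ _ _).1 (@cvg_powmx _ _ D _ r0) (rshift 1 i) (lshift m.+1 j).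
  exact: (h _).
- move=> r r0; rewrite !powmxE.
  have := eq_fdd_mul (row_mx 0 1%:M : 'M[R]_(m.+1, 1 + m.+1)) (HD (ln r)).
  have -> : (fun t w => row_mx 0 1%:M *m Y (expmx (ln r *: E) *m t) w) =
      (fun t w => X (expmx (ln r *: E) *m t) w).
    apply/funext => t; apply/funext => w.
    by rewrite /Y /homogenize mul_row_col mul0mx mul1mx add0r.
  have -> // : (fun t w => row_mx 0 1%:M *m ((expmx (ln r *: D) : 'M[R]_(1 + m.+1)) *m Y t w)) =
      (fun t w => expmx (ln r *: D') *m X t w + b r).
  apply/funext => t; apply/funext => w.
  rewrite /b powmxE -(drsubmx_expmx Dtop).
  rewrite -[X in _ *m (X *m _)](@submxK _ 1 m.+1 1 m.+1) /Y /homogenize.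
  by rewrite mul_block_col mul_row_col mul0mx add0r mul1mx mulmx1 addrC.
Qed.

End OperatorScaling.

(* The dimensions of the time and value spaces are d.+2 and m.+2, i.e. arbitrary
   integers at least 2. *)
Theorem theorem2p2 (R : realType) (disp : measure_display)
    (T : measurableType disp) (P : probability T R) (d m : nat)
    (X : 'cV[R]_d.+2 -> T -> 'cV[R]_m.+2)
    (X_field : random_field X)
    (X_cont : stochastically_continuous P X)
    (X_proper : proper_field P X) :
  (forall E : 'M[R]_d.+2, Qmx E -> oss P X E ->
     exists D : 'M[R]_m.+2,
       [/\ Mmx D,
           (forall r : R, 0 < r ->
              eq_fdd P (fun t w => X (powmx r E *m t) w)
                       (fun t w => powmx r D *m X t w))
         & (Qmx D <-> {ae P, forall w, X 0 w = 0})])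
  /\
  (forall E : 'M[R]_d.+2, Qmx E -> oss_HM P X E ->
     exists (D : 'M[R]_m.+2) (b : R -> 'cV[R]_m.+2),
       [/\ Mmx D,
           {within `]0, +oo[, continuous b}
         & (forall r : R, 0 < r ->
              eq_fdd P (fun t w => X (powmx r E *m t) w)
                       (fun t w => powmx r D *m X t w + b r))]).
Proof.
by split=> E QE; [exact: oss_exponent | exact: oss_HM_exponent].
Qed.
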